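(* For positive integers $n$ and $m$ with $m\le n$, let $r(n,m)$ denote the number of forest chord diagrams with $n$ chords whose intersection graph has exactly $m$ connected components (trees), each tree being rooted (i.e., counted together with a choice of one distinguished chord in each connected component of the intersection graph). Then \[ r(n,m)=\frac{1}{m}\binom{2n}{m-1}\big(\Sigma_1+\Sigma_2\big), \] where \[ \Sigma_1=\sum_{k=0}^{m}\sum_{j=0}^{n-m-1}(-1)^k\binom{m}{k}\binom{m+j-1}{j}2^{m-k}3^j\,\frac{2j+k}{n-m-j}\binom{3n-3m+k-j-1}{n-m-j-1} \] and \[ \Sigma_2=\sum_{k=0}^{m}(-1)^k\binom{m}{k}\binom{n-1}{n-m}2^{m-k}3^{n-m}. \]
   Context: A chord diagram of size $n$ is a perfect matching (pairing) of the $2n$ points labeled $1,\dots,2n$, placed in clockwise order on a circle; each pair is drawn as a chord. Two chord diagrams are the same exactly when they are the same pairing of $\{1,\dots,2n\}$. Two chords $\{a,c\}$ and $\{b,d\}$ with $a<c$, $b<d$ cross if $a<b<c<d$ or $b<a<d<c$. The intersection graph $G_{\mathcal C}$ of a chord diagram $\mathcal C$ has the chords of $\mathcal C$ as vertices, two vertices being adjacent iff the corresponding chords cross. $\mathcal C$ is a forest chord diagram if $G_{\mathcal C}$ is a forest (acyclic graph). Empty sums (e.g. when $n=m$) are $0$. *)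

(* Defs.v *)
(* World: MathComp. *)
From mathcomp Require Import all_boot all_order all_algebra.

Set Implicit Arguments.
Unset Strict Implicit.
Unset Printing Implicit Defensive.

(* A graph on a finite type is given by its adjacency relation.  A cycle has
   pairwise distinct vertices and length at least 3; [p] ranges over tuples of
   length at most #|V| only to make the property decidable (see acyclicP). *)
Definition acyclic (V : finType) (e : rel V) : bool :=
  [forall k : 'I_#|V|.+1, forall p : k.-tuple V, (2 < k) ==> ~~ ucycleb e p].

Lemma acyclicP (V : finType) (e : rel V) :
  reflect (forall p : seq V, 2 < size p -> ~ ucycle e p) (acyclic e).
Proof.
apply: (iffP forallP) => [acy p p_gt2 ucyc_p | acy k].
  have p_le : size p < #|V|.+1.
    by have/andP[_ /card_uniqP <-] := ucyc_p; rewrite ltnS max_card.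
  have/forallP/(_ (in_tuple p))/implyP/(_ p_gt2) := acy (Ordinal p_le).
  by move/negP; apply.
apply/forallP=> p; apply/implyP=> k_gt2; apply/negP.
by apply: acy; rewrite size_tuple.
Qed.

Section ChordDiagrams.

Variable n : nat.

(* The 2n points on the circle are labelled 0, ..., 2n - 1 in clockwise
   order. *)
Definition point := 'I_(2 * n).

Definition is_chord_diagram (C : {set {set point}}) : bool :=
  partition C [set: point] && [forall A in C, #|A| == 2].

Definition crossing (A B : {set point}) : bool :=
  [exists a, exists b, exists c, exists d : point,
    [&& A == [set a; c], B == [set b; d]
      & [&& a < b, b < c & c < d] || [&& b < a, a < d & d < c]]].

(* Adjacency in the intersection graph of C.  Its vertices are the chords of
   C: sets of points not in C are related to nothing, so they lie on no cycle,
   and they are excluded from the components below. *)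
Definition intersection_graph (C : {set {set point}}) : rel {set point} :=
  [rel A B | [&& A \in C, B \in C & crossing A B]].

Definition is_forest_chord_diagram (C : {set {set point}}) : bool :=
  is_chord_diagram C && acyclic (intersection_graph C).

Definition components (C : {set {set point}}) : {set {set {set point}}} :=
  equivalence_partition (connect (intersection_graph C)) C.

(* A choice of roots is encoded as the set of the distinguished chords. *)
Definition is_rooting (C roots : {set {set point}}) : bool :=
  (roots \subset C) && [forall K in components C, #|roots :&: K| == 1].

End ChordDiagrams.

Definition r (n m : nat) : nat :=
  #|[set CR : {set {set point n}} * {set {set point n}} |
      [&& is_forest_chord_diagram CR.1, #|components CR.1| == m
        & is_rooting CR.1 CR.2]]|.

Local Open Scope ring_scope.

(* For 0 < m <= n no natural number subtraction below is truncated; the bounds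
   m.+1 and n - m are exclusive. *)
Definition Sigma1 (n m : nat) : rat :=
  \sum_(0 <= k < m.+1) \sum_(0 <= j < n - m)
    (-1) ^+ k * 'C(m, k)%:R * 'C(m + j - 1, j)%:R * 2 ^+ (m - k) * 3 ^+ j
    * ((2 * j + k)%:R / (n - m - j)%:R)
    * 'C(3 * n - 3 * m + k - j - 1, n - m - j - 1)%:R.

Definition Sigma2 (n m : nat) : rat :=
  \sum_(0 <= k < m.+1)
    (-1) ^+ k * 'C(m, k)%:R * 'C(n - 1, n - m)%:R * 2 ^+ (m - k)
    * 3 ^+ (n - m).

(* Main.v *)
Require Import Defs.
From mathcomp Require Import all_boot all_order all_algebra.
From mathcomp Require Import ring zify.

(* Scan the points from left to right.  When a chord A is closed it crosses
   exactly the open chords opened after A, so the intersection graph grows by a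
   star centred at A; it stays acyclic iff A and these chords lie in distinct
   components.  Components do not interleave on the stack of open chords, so this
   means that A is the last open chord of its component and that each component
   above it has a single open chord; all of them then merge.  Hence forest chord
   diagrams are the words accepted by an automaton whose state is a stack of
   pairs (number of open chords, number of chords), and one counts walks of this
   automaton, a finished component with j chords being weighted by u j, where j
   is the number of its rootings and u marks components.

   Let B = 1 + v B^3 and let T = sum_j j [v^(j-1)]B v^j be the generating
   function of rooted trees.  If D = x (1 + u T(D^2)), the generating function
   in x of the walks that empty a given stack is D / x times an explicit power
   series in D, which is checked against the one-step recurrence; for the empty
   stack it is D / x.  Lagrange inversion gives
     [x^(2n) u^m] D / x = 1 / m * 'C(2n, m - 1) * [v^n] T^m,
   and T (1 - 3 v B^2) = v (2 - B) yields the double sum. *)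

Set Implicit Arguments.
Unset Strict Implicit.
Unset Printing Implicit Defensive.
Import GRing.Theory Num.Theory.

(** * Acyclicity and components when a star is added to a graph *)

Lemma sub_acyclic (V : finType) (e e' : rel V) :
  subrel e' e -> acyclic e -> acyclic e'.
Proof.
move=> sub /acyclicP acy; apply/acyclicP=> p p_gt2 /andP[cyc uniq_p].
by apply: (acy p p_gt2); rewrite /ucycle (sub_cycle sub cyc).
Qed.

Section Star.
Variables (V : finType) (e : rel V) (a : V) (S : seq V).
Hypothesis e_sym : symmetric e.

Definition add_star : rel V :=
  [rel x y | [|| e x y, (x == a) && (y \in S) | (y == a) && (x \in S)]].

Lemma add_starE x y : add_star x y =
  [|| e x y, (x == a) && (y \in S) | (y == a) && (x \in S)].
Proof. by []. Qed.

Lemma add_star_sub : subrel e add_star.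
Proof. by move=> x y exy; rewrite add_starE exy. Qed.

Lemma add_star_sym : symmetric add_star.
Proof. by move=> x y; rewrite !add_starE e_sym [X in _ || X]orbC. Qed.

Lemma add_starN x y : x != a -> y != a -> add_star x y = e x y.
Proof. by move=> /negPf xa /negPf ya; rewrite add_starE xa ya !orbF. Qed.

Lemma add_star_acyclic :
  {in a :: S &, forall x y, x != y -> ~~ connect e x y} ->
  acyclic e -> acyclic add_star.
Proof.
move=> sep /acyclicP acy; apply/acyclicP=> p p_gt2 ucyc_p.
have [ap|a_p] := boolP (a \in p); last first.
  apply: (acy p p_gt2); case/andP: ucyc_p => cyc_p uniq_p; apply/andP; split=> //.
  apply: (@sub_in_cycle _ [in p] add_star e) cyc_p; last exact/allP.
  move=> x y xp yp; rewrite add_starN //; [move: xp|move: yp]; apply: contraTneq => -> //.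
have [i q def_q] := rot_to ap.
move: ucyc_p p_gt2; rewrite -(rot_ucycle i) -(size_rot i) def_q.
case: q def_q => [|x [|z q]] //= _ /andP[cyc uq] _.
move: (cyc); rewrite /= rcons_path => /and4P[ax xz path_z ya].
move: (uq) => /=; rewrite !inE !negb_or => /and4P[/and3P[ax' az' a_q] /andP[xz' x_q] _ _].
set y := last z q in ya.
have path_xy : path e x (z :: q).
  apply: (@sub_in_path _ (predC1 a) add_star e); last by rewrite /= xz.
    by move=> v w /= va wa; rewrite (@add_starN v w).
  rewrite /= eq_sym ax' eq_sym az' /=; apply/allP => v vq /=.
  by apply: contraNneq a_q => <-.
have con_xy : connect e x y by apply/connectP; exists (z :: q).
have a_y : a != y.
  apply: contraNneq a_q => E; have := mem_last z q; rewrite -/y -E inE.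
  by rewrite (negPf az').
have x_y : x != y.
  apply: contraNneq x_q => E; have := mem_last z q; rewrite -/y -E inE.
  by rewrite (negPf xz').
have {}ax : e a x || (x \in S).
  by move: ax; rewrite add_starE eqxx /= [x == a]eq_sym (negPf ax') orbF.
have {}ya : e y a || (y \in S).
  by move: ya; rewrite add_starE eqxx /= [y == a]eq_sym (negPf a_y).
have inS v : v \in S -> v \in a :: S by rewrite inE orbC => ->.
have [exa|exa] := boolP (e a x); have [eya|eya] := boolP (e y a).
- apply: (acy [:: a, x, z & q]) => //; apply/andP; split=> //.
  by rewrite /= rcons_path exa eya andbT.
- rewrite (negPf eya) /= in ya.
  have /negP := sep a y (mem_head _ _) (inS _ ya) a_y.
  by apply; apply: connect_trans con_xy; apply: connect1.
- rewrite (negPf exa) /= in ax.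
  have x_a : x != a by rewrite eq_sym.
  have /negP := sep x a (inS _ ax) (mem_head _ _) x_a.
  by apply; apply: connect_trans con_xy _; apply: connect1.
- rewrite (negPf exa) /= in ax; rewrite (negPf eya) /= in ya.
  by have /negP := sep x y (inS _ ax) (inS _ ya) x_y; apply.
Qed.

Let e_csym : connect_sym e. Proof. exact: sym_connect_sym. Qed.

Lemma add_star_cyclic x y :
  {in S, forall s, ~~ e a s} -> a \notin S ->
  x \in a :: S -> y \in a :: S -> x != y -> connect e x y -> ~~ acyclic add_star.
Proof.
move=> new aS.
have case_a s : s \in S -> connect e a s -> ~~ acyclic add_star.
  move=> sS /connectP[p0 path_p0 def_s].
  case/shortenP: path_p0 def_s => p path_p uniq_p _ def_s.
  apply/negP => /acyclicP/(_ (a :: p)); apply.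
    case: p path_p uniq_p def_s => [|v [|w p]] //= path_p _ def_s.
      by rewrite def_s (negPf aS) in sS.
    by rewrite -def_s (negPf (new _ sS)) in path_p.
  apply/andP; split=> //; rewrite /= rcons_path -def_s add_starE sS eqxx !orbT andbT.
  exact: sub_path add_star_sub _ _ path_p.
rewrite !inE => /predU1P[->|xS] /predU1P[->|yS] x_y con_xy.
- by rewrite eqxx in x_y.
- exact: case_a con_xy.
- by apply: (case_a x) => //; rewrite e_csym.
case/connectP: (con_xy) => p0 path_p0 def_y.
case/shortenP: path_p0 def_y => p path_p uniq_p _ def_y.
have [ap|ap] := boolP (a \in x :: p).
  apply: (case_a x) => //; rewrite e_csym; exact: path_connect path_p _ ap.
apply/negP => /acyclicP/(_ [:: a, x & p]); apply.
  by case: p {path_p uniq_p ap} def_y => //= E; rewrite E eqxx in x_y.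
apply/andP; split; last by rewrite cons_uniq ap.
rewrite /= rcons_path -def_y !add_starE xS yS eqxx /= !orbT !andbT.
by apply: sub_path path_p; apply: add_star_sub.
Qed.
End Star.

Section ComponentList.
Variable V : finType.
Implicit Types (e : rel V) (Ks : seq {set V}) (K : {set V}) (D : pred V).

Definition is_comps e Ks D :=
  [/\ forall x, count (fun K => x \in K) Ks = D x, set0 \notin Ks,
      {in Ks, forall K, {in K &, forall x y, connect e x y}}
    & {in Ks, forall K x y, x \in K -> e x y -> y \in K}].

Lemma is_comps_perm e Ks Ks' D : perm_eq Ks Ks' -> is_comps e Ks D -> is_comps e Ks' D.
Proof.
move=> eqK [cnt ne con clo]; split=> [x||K|K].
- by rewrite -cnt; apply/esym/permP.
- by rewrite -(perm_mem eqK).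
- by rewrite -(perm_mem eqK); apply: con.
- by rewrite -(perm_mem eqK); apply: clo.
Qed.

Lemma eq_is_comps e e' Ks D D' : e =2 e' -> D =1 D' ->
  is_comps e Ks D -> is_comps e' Ks D'.
Proof.
move=> eq_e eq_D [cnt ne con clo]; split=> [x|//|K KK x y xK yK|K KK x y xK].
- by rewrite -eq_D.
- by rewrite -(eq_connect eq_e); apply: con yK.
- by rewrite -eq_e; apply: clo.
Qed.

Lemma is_comps_connect e Ks D K x y : is_comps e Ks D -> K \in Ks ->
  x \in K -> connect e x y -> y \in K.
Proof.
case=> _ _ _ clo KK xK /connectP[p path_p ->].
elim: p x xK path_p => //= z p IH x xK /andP[xz path_p].
by apply: IH path_p; apply: clo xz.
Qed.

Lemma is_comps_disjoint e K Ks D K' x : is_comps e (K :: Ks) D ->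
  K' \in Ks -> x \in K -> x \in K' -> False.
Proof.
case=> cnt _ _ _ K'K xK xK'; have := cnt x; rewrite /= xK.
have: has (fun K => x \in K) Ks by apply/hasP; exists K'.
by rewrite has_count; case: (D x); case: (count _ _).
Qed.

Lemma is_comps_mem e Ks D x : is_comps e Ks D ->
  D x = has (fun K => x \in K) Ks.
Proof. by case=> cnt _ _ _; rewrite has_count cnt; case: (D x). Qed.

Lemma is_comps_inj e Ks D K K' x : is_comps e Ks D -> K \in Ks -> K' \in Ks ->
  x \in K -> x \in K' -> K = K'.
Proof.
move=> cK KK KK' xK xK'; apply/eqP/negPn/negP => neq.
have := is_comps_perm (perm_to_rem KK) cK.
move/is_comps_disjoint/(_ _ xK xK'); apply.
by move: KK'; rewrite (perm_mem (perm_to_rem KK)) inE eq_sym (negPf neq).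
Qed.

Lemma is_comps_partition e Ks D : is_comps e Ks D ->
  uniq Ks /\ equivalence_partition (connect e) [set x | D x] = [set K in Ks].
Proof.
move=> cK; have [cnt ne con clo] := cK.
have inh K : K \in Ks -> exists x, x \in K.
  by move=> KK; apply/set0Pn; apply: contraNneq ne => <-.
split.
  apply: count_mem_uniq => K; case KK: (K \in Ks); last exact/count_memPn/negbT.
  have [x xK] := inh K KK; apply/eqP; rewrite eqn_leq -has_count has_pred1 KK andbT.
  apply: (@leq_trans (count (fun K => x \in K) Ks)).
    by apply: sub_count => K' /= /eqP ->.
  by rewrite cnt; case: (D x).
have class K x : K \in Ks -> x \in K ->
    [set y in [set x | D x] | connect e x y] = K.
  move=> KK xK; apply/setP=> y; rewrite !inE; apply/andP/idP => [[_]|yK].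
    exact: is_comps_connect cK KK xK.
  split; last exact: con KK _ _ xK yK.
  by rewrite (is_comps_mem y cK); apply/hasP; exists K.
apply/setP=> K; rewrite inE; apply/imsetP/idP => [[x]|KK].
  rewrite inE (is_comps_mem x cK) => /hasP[K' KK' xK'] ->.
  by rewrite (class K').
have [x xK] := inh K KK; exists x; last by rewrite (class K).
by rewrite inE (is_comps_mem x cK); apply/hasP; exists K.
Qed.

Lemma mem_bigcup_seq Ks x :
  (x \in \bigcup_(K <- Ks) K) = has (fun K => x \in K) Ks.
Proof.
elim: Ks => [|K Ks IH]; first by rewrite big_nil inE.
by rewrite big_cons inE IH.
Qed.

Lemma card_bigcup_seq Ks : (forall x, count (fun K => x \in K) Ks <= 1) ->
  #|\bigcup_(K <- Ks) K| = \sum_(K <- Ks) #|K|.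
Proof.
elim: Ks => [|K Ks IH] cnt; first by rewrite !big_nil cards0.
rewrite !big_cons -IH => [|x]; last first.
  by apply: leq_trans (cnt x) => /=; apply: leq_addl.
rewrite -cardsUI.
rewrite (_ : K :&: _ = set0) ?cards0 ?addn0 //.
apply/setP=> x; rewrite !inE mem_bigcup_seq; apply/negP => /andP[xK].
by rewrite has_count; have := cnt x; rewrite /= xK; case: (count _ _).
Qed.

Lemma add_star_comps e a (S : seq V) K0 Ls Ks D : symmetric e ->
  is_comps e (K0 :: Ls ++ Ks) D -> a \in K0 ->
  {in Ls, forall L : {set V}, exists2 s, s \in S & s \in L} ->
  {in S, forall s, exists2 L, L \in Ls & s \in L} ->
  is_comps (add_star e a S) ((\bigcup_(L <- K0 :: Ls) L) :: Ks) D.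
Proof.
move=> e_sym cK aK0 LS SL; have [cnt ne con clo] := cK.
set U := \bigcup_(L <- _) L.
have inU L x : L \in K0 :: Ls -> x \in L -> x \in U.
  by move=> LL xL; rewrite mem_bigcup_seq; apply/hasP; exists L.
have aU : a \in U by apply: inU aK0; apply: mem_head.
have SU s : s \in S -> s \in U.
  by case/SL=> L LL; apply: inU; rewrite inE LL orbT.
have disj K x : K \in Ks -> x \in K -> x \in U -> False.
  move=> KK xK; rewrite mem_bigcup_seq has_count => xU; have := cnt x.
  rewrite -cat_cons count_cat; have : has (fun K => x \in K) Ks by apply/hasP; exists K.
  by rewrite has_count; case: (D x); lia.
split.
- move=> x; have := cnt x; rewrite -cat_cons count_cat => <- /=; congr (_ + _).
  have := cnt x; rewrite -cat_cons count_cat /U mem_bigcup_seq has_count.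
  by case: (D x) => /=; lia.
- rewrite inE negb_or; apply/andP; split.
    by apply: contraTneq aU => <-; rewrite inE.
  by apply: contraNN ne; rewrite inE mem_cat => ->; rewrite !orbT.
- move=> K; rewrite inE => /predU1P[->|KK] x y; last first.
    move=> xK yK; apply: (connect_sub _ (con K _ _ _ xK yK)).
      by move=> v w vw; apply/connect1/add_star_sub.
    by rewrite inE mem_cat KK !orbT.
  have sym' := sym_connect_sym (add_star_sym a S e_sym).
  have to_a v : v \in U -> connect (add_star e a S) a v.
    rewrite mem_bigcup_seq => /hasP[L LL vL].
    have mono x1 x2 : connect e x1 x2 -> connect (add_star e a S) x1 x2.
      by apply: connect_sub => z1 z2 z12; apply/connect1/add_star_sub.
    move: LL; rewrite inE => /predU1P[LK|LL].
      apply/mono/(con K0); rewrite ?mem_head -?LK //.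
      by rewrite LK.
    have [s sS sL] := LS L LL.
    apply: (@connect_trans _ _ s).
      by apply: connect1; rewrite add_starE sS eqxx !orbT.
    by apply/mono/(con L); rewrite // inE mem_cat LL !orbT.
  by move=> xU yU; apply: connect_trans (to_a y yU); rewrite sym' to_a.
- move=> K; rewrite inE => /predU1P[->|KK] x y xK; rewrite add_starE;
  case/or3P=> [exy|/andP[/eqP xa yS]|/andP[/eqP ya xS]].
  + move: xK; rewrite mem_bigcup_seq => /hasP[L LL xL].
    by apply: (inU L) => //; apply: (clo L _ x) => //; rewrite -cat_cons mem_cat LL.
  + exact: SU.
  + by rewrite ya.
  + by apply: (clo K _ x) => //; rewrite inE mem_cat KK !orbT.
  + by case: (disj K x) => //; rewrite xa.
  + by case: (disj K x) => //; apply: SU.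
Qed.
End ComponentList.

Local Open Scope ring_scope.

(** * Lagrange inversion and the weighted walks of block stacks *)

(* [beta i p] is the coefficient of v^i in B^p, where B = 1 + v B^3. *)
Fixpoint beta (i p : nat) : nat :=
  if i is i'.+1 then (\sum_(0 <= q < p) beta i' q.+3)%N else 1%N.

Lemma beta_p0 i : beta i.+1 0 = 0%N.
Proof. by rewrite /= big_geq. Qed.

Lemma betaS i p : beta i.+1 p.+1 = (beta i.+1 p + beta i p.+3)%N.
Proof. by rewrite /= big_nat_recr. Qed.

Lemma beta_closed i p : (i.+1 * beta i.+1 p = p * 'C(3 * i + p + 2, i))%N.
Proof.
elim: i p => [|i IH] p.
  rewrite mul1n /= (eq_bigr (fun=> 1%N)) // sum_nat_const_nat subn0.
  by rewrite bin0.
elim: p => [|p IHp]; first by rewrite beta_p0 muln0.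
rewrite betaS mulnDr IHp.
apply/eqP; rewrite -(eqn_pmul2l (ltn0Sn i)) mulnDr; apply/eqP.
have := IH p.+3.
have -> : (3 * i + p.+3 + 2 = 3 * i.+1 + p + 2)%N by lia.
have -> : (3 * i.+1 + p.+1 + 2 = (3 * i.+1 + p + 2).+1)%N by lia.
rewrite binS => IHq.
have bin_succ := mul_bin_left (3 * i.+1 + p + 2) i.
have X : (3 * i.+1 + p + 2 - i = 2 * i + p + 5)%N by lia.
rewrite {}X in bin_succ.
move: ('C(_, i.+1)) ('C(_, i)) (beta i.+1 p.+3) bin_succ IHq => c1 c0 b.
nia.
Qed.

Arguments beta : simpl never.

Section LagrangeInversion.
Variables (K : idomainType) (psi : {poly K}).
Hypothesis charK : [pchar K] =i pred0.

(* [lagr N f] is the coefficient of x^N in f(D), where D = x psi(D). *)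
Fixpoint lagr (N : nat) (f : {poly K}) : K :=
  if N is N'.+1 then lagr N' (psi * drop_poly 1 f) else f`_0.

Lemma lagrD N f g : lagr N (f + g) = lagr N f + lagr N g.
Proof.
elim: N f g => [|N IH] f g /=; first by rewrite coefD.
by rewrite linearD mulrDr IH.
Qed.

Lemma lagrZ N c f : lagr N (c *: f) = c * lagr N f.
Proof.
elim: N f => [|N IH] f /=; first by rewrite coefZ.
by rewrite linearZ -scalerAr IH.
Qed.

Lemma lagr0 N : lagr N 0 = 0.
Proof. by rewrite -[X in lagr N X](scale0r 0) lagrZ mul0r. Qed.

Lemma lagrMX N f : lagr N.+1 ('X * f) = lagr N (psi * f).
Proof.
rewrite /= (_ : drop_poly 1 ('X * f) = f) //.
by rewrite -['X]expr1 mulrC drop_polyMXn_id.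
Qed.

Lemma lagrC N c : lagr N.+1 c%:P = 0.
Proof.
rewrite /= drop_poly_eq0; last by rewrite size_polyC leq_b1.
by rewrite mulr0; elim: N => [|N IH] /=; rewrite ?coef0 // linear0 mulr0.
Qed.

Lemma lagrange_inversion N f :
  N.+1%:R * lagr N.+1 f = (f^`() * psi ^+ N.+1)`_N.
Proof.
elim: N f => [|N IH] f.
  by rewrite mul1r /= expr1 !coef0M coef_deriv coef_drop_poly mulr1n mulrC.
have -> : lagr N.+2 f = lagr N.+1 (psi * drop_poly 1 f) by [].
have {2}-> : f = (f`_0)%:P + 'X * drop_poly 1 f.
  apply/polyP=> -[|i]; rewrite coefD coefC coefXM ?addr0 //=.
  by rewrite add0r coef_drop_poly addn1.
move: (drop_poly 1 f) (f`_0) => g c.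
have N1 : N.+1%:R != 0 :> K by move/pcharf0P: charK => ->.
apply: (mulfI N1); rewrite mulrCA IH derivD derivC add0r !derivM derivX mul1r.
have := congr1 (fun p : {poly K} => p`_N) (derivM g (psi ^+ N.+2)).
rewrite /= coef_deriv deriv_exp /= coefD.
rewrite [g * (_ *+ N.+2)]mulrnAr coefMn.
move=> E.
have -> : (psi^`() * g + psi * g^`()) * psi ^+ N.+1 =
    g * (psi^`() * psi ^+ N.+1) + g^`() * psi ^+ N.+2 by rewrite !exprS; ring.
rewrite [(g + _) * _]mulrDl !coefD -['X * _ * _]mulrA coefXM /= [RHS]mulrDr.
rewrite [N.+1%:R * (g * _)`_ _]mulr_natl E.
move: (g * _)`_N (g^`() * _)`_N => a b.
rewrite -[a *+ _]mulr_natl -[N.+2%:R]natr1; move: N.+1%:R => x; ring.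
Qed.
End LagrangeInversion.

Arguments lagr : simpl never.

(* A block (b, j) is a component under construction with j chords, b of which
   are still open; the top of the stack comes first. *)
Definition stack := seq (nat * nat).

Section Walks.
Variables (K : idomainType) (u : K) (M : nat).

(* The weight of a component with i chords, cut off at M so that the sums
   defining [theta] are finite and yet satisfy [theta_step] exactly. *)
Definition omega (i : nat) : nat := if (i < M)%N then i else 0%N.

(* The weighted outcomes of closing a chord: it crosses the q open chords,
   lying in singleton blocks with i chords in all, that were skipped so far. *)
Fixpoint closings (s : stack) (q i : nat) : seq (K * stack) :=
  if s is (b, j) :: s' then
    (if (b + q).-1 == 0%N then (u * (omega (j + i))%:R, s')
     else (1, ((b + q).-1, (j + i)%N) :: s'))
    :: (if b == 1%N then closings s' q.+1 (j + i) else [::])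
  else [::].

Fixpoint walks (k : nat) (s : stack) : K :=
  if k is k'.+1 then
    walks k' ((1%N, 1%N) :: s)
    + \sum_(cs <- closings s 0 0) cs.1 * walks k' cs.2
  else (s == [::])%:R.

(* For h = w B(y w^2), that is h = w / (1 - y h^2), [theta p j r] is the image
   of y^j h^p (h / w)^r under the linear map y^i |-> omega i. *)
Definition theta (p j r : nat) : {poly K} :=
  \sum_(i < M) (beta i (p + r) * omega (i + j))%:R *: 'X^(p + 2 * i).

Lemma thetaMX p j r : 'X * theta p j r.+1 = theta p.+1 j r.
Proof.
rewrite /theta mulr_sumr; apply: eq_bigr => i _.
by rewrite -scalerAr -exprS addSnnS addSn.
Qed.

Lemma theta_step p j r : theta p j r.+1 = theta p j r + theta p.+2 j.+1 r.+1.
Proof.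
have om0 i : (M <= i)%N -> omega i = 0%N by rewrite /omega ltnNge => ->.
rewrite /theta; move: omega om0 => om; case: M => [|M'] om0.
  by rewrite !big_ord0 addr0.
rewrite big_ord_recl [in RHS]big_ord_recl /= -addrA; congr (_ + _).
rewrite [X in _ = _ + X]big_ord_recr /=.
rewrite om0 ?addnS ?ltnS ?leq_addr // muln0 scale0r addr0 -big_split /=; apply: eq_bigr => i _.
rewrite /bump /= !add1n.
rewrite -[X in _ = _ + _ *: X](_ : 'X^(p + 2 * i.+1) = _); last first.
  by congr ('X^_); lia.
by rewrite addnS -!addSnnS betaS -scalerDl -natrD -mulnDl !addSn.
Qed.

Lemma theta00 j : theta 0 j 0 = (omega j)%:R%:P.
Proof.
have om0 i : (M <= i)%N -> omega i = 0%N by rewrite /omega ltnNge => ->.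
rewrite /theta; move: omega om0 => om; case: M => [|M'] om0.
  by rewrite big_ord0 om0.
rewrite big_ord_recl big1 ?addr0 => [|i _]; last first.
  by rewrite beta_p0 mul0n scale0r.
by rewrite mul1n expr0 alg_polyC.
Qed.

(* Pgf s is the power series in D such that (D / x) Pgf s is the generating
   function in x of the walks that empty s.  Qgf s p i 0 is the contribution of
   the walks that start by closing a chord of s, when p.+1 singleton blocks with
   i chords in all lie above s, and Qgf s p i r inserts the factor (h / w)^r. *)
Fixpoint PQ (s : stack) : {poly K} * (nat -> nat -> nat -> {poly K}) :=
  if s is (b, j) :: s' then
    let PQ' := PQ s' in
    let X p i r := u *: (PQ'.1 * theta p i r) + PQ'.2 p i r.+1 in
    (X b j 0%N, fun p i r => X (b + p)%N (j + i)%N r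
       + (if b == 1%N then PQ'.2 p.+1 (j + i)%N r else 0))
  else (1, fun _ _ _ => 0).

Definition Pgf s := (PQ s).1.
Definition Qgf s := (PQ s).2.
Definition Xgf s p i r := u *: (Pgf s * theta p i r) + Qgf s p i r.+1.

Lemma PgfE b j s : Pgf ((b, j) :: s) = Xgf s b j 0. Proof. by []. Qed.

Lemma QgfE b j s p i r : Qgf ((b, j) :: s) p i r =
  Xgf s (b + p) (j + i) r + (if b == 1%N then Qgf s p.+1 (j + i) r else 0).
Proof. by []. Qed.

Lemma QgfMX s p i r : 'X * Qgf s p i r.+1 = Qgf s p.+1 i r.
Proof.
elim: s p i r => [|[b j] s IH] p i r; first by rewrite mulr0.
rewrite !QgfE mulrDr /Xgf mulrDr -scalerAr mulrCA thetaMX IH addnS.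
by case: eqP; rewrite ?IH ?mulr0.
Qed.

Lemma XgfMX s p i r : 'X * Xgf s p i r.+1 = Xgf s p.+1 i r.
Proof. by rewrite /Xgf mulrDr -scalerAr mulrCA thetaMX QgfMX. Qed.

Lemma Qgf_step s p i r : Qgf s p i r.+1 = Qgf s p i r + Qgf s p.+2 i.+1 r.+1.
Proof.
elim: s p i r => [|[b j] s IH] p i r; first by rewrite addr0.
rewrite !QgfE /Xgf theta_step [Qgf s (b + p) _ r.+2]IH !addnS mulrDr scalerDr.
rewrite addrACA; case: eqP => _; last by rewrite !addr0.
rewrite [Qgf s p.+1 (j + i)%N r.+1]IH; exact: addrACA.
Qed.

Lemma Xgf_step s p i r : Xgf s p i r.+1 = Xgf s p i r + Xgf s p.+2 i.+1 r.+1.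
Proof. by rewrite /Xgf theta_step [Qgf s p i _]Qgf_step mulrDr scalerDr addrACA. Qed.

Definition pos_stack (s : stack) := all (fun x => 0 < x.1)%N s.

Lemma sum_closings s q i : pos_stack s ->
  \sum_(cs <- closings s q.+1 i) cs.1 *: Pgf cs.2 = Qgf s q i 0.
Proof.
elim: s q i => [|[b j] s IH] q i /=; first by rewrite big_nil.
case/andP=> /= b_gt0 pos_s; rewrite big_cons addnS /=.
rewrite (_ : (b + q == 0)%N = false) /=; last by lia.
rewrite scale1r PgfE QgfE; congr (_ + _).
by case: eqP => _; [rewrite IH|rewrite big_nil].
Qed.

Definition psi : {poly K} := 1 + u *: ('X * theta 1 1 0).

Lemma psi_Pgf s : pos_stack s ->
  psi * Pgf s = (s == [::])%:R
    + 'X * (Pgf ((1%N, 1%N) :: s)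
            + \sum_(cs <- closings s 0 0) cs.1 *: Pgf cs.2).
Proof.
move=> pos_s; rewrite PgfE /Xgf /psi mulrDl mul1r.
have -> : u *: ('X * theta 1 1 0) * Pgf s = 'X * (u *: (Pgf s * theta 1 1 0)).
  by rewrite -!scalerAr -scalerAl; congr (_ *: _); ring.
suff -> : Pgf s = (s == [::])%:R +
    'X * (Qgf s 1 1 1 + \sum_(cs <- closings s 0 0) cs.1 *: Pgf cs.2).
  by rewrite -addrA -mulrDr; congr (_ + 'X * _); rewrite addrC addrA.
case: s pos_s => [|[b j] s]; first by rewrite big_nil addr0 mulr0 addr0.
case/andP=> /= b_gt0 pos_s; rewrite add0r mulrDr QgfMX QgfE PgfE big_cons.
rewrite !addn0 addn2 addn1.
have step c : Xgf s c.+1 j 0 = 'X * Xgf s c j 0 + Xgf s c.+3 j.+1 0.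
  by rewrite -XgfMX Xgf_step mulrDr XgfMX.
have [b1|b_n1] := eqVneq b 1%N.
  rewrite {b}b1 /= in b_gt0 *; rewrite sum_closings // step.
  have -> : Xgf s 0 j 0 =
      (u * (omega j)%:R) *: Pgf s + Qgf s 0 j 0 + Qgf s 2 j.+1 1.
    by rewrite /Xgf theta00 [_ * _%:P]mulrC mul_polyC scalerA Qgf_step addrA.
  rewrite [RHS]addrC [in LHS]mulrDr QgfMX -addrA; congr (_ + _).
  exact: addrC.
rewrite big_nil !addr0 /=; case: b b_n1 b_gt0 => [|[|b]] //= _ _.
by rewrite scale1r step addrC.
Qed.

Lemma pos_closings s q i : pos_stack s ->
  all (fun cs => pos_stack cs.2) (closings s q i).
Proof.
elim: s q i => [|[b j] s IH] q i //= /andP[b_gt0 pos_s].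
apply/andP; split; last by case: eqP => // _; apply: IH.
by case: eqP => //= /eqP; rewrite -lt0n => ->.
Qed.

Lemma walksE k s : pos_stack s -> walks k s = lagr psi k.+1 ('X * Pgf s).
Proof.
elim: k s => [|k IH] s pos_s; rewrite lagrMX psi_Pgf //.
  rewrite /lagr /= coefD coefXM addr0.
  by case: eqP; rewrite ?coef1 ?coef0.
rewrite lagrD [X in _ = X + _](_ : _ = 0) ?add0r; last first.
  by rewrite -[_%:R]polyC_natr lagrC.
rewrite mulrDr lagrD /= IH //; congr (_ + _).
have := pos_closings 0 0 pos_s; elim: (closings s 0 0) => [_|cs l IHl].
  by rewrite !big_nil mulr0 lagr0.
case/andP=> pos_cs /IHl; rewrite !big_cons mulrDr lagrD => ->.
by rewrite -scalerAr lagrZ IH.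
Qed.
End Walks.

(** * Coefficients of the generating function of rooted trees *)

Section Truncation.
Variable (R : comNzRingType).
Implicit Types p q : {poly R}.

Definition eq_modX (d : nat) p q := forall i, (i < d)%N -> p`_i = q`_i.

Lemma eq_modX_refl d p : eq_modX d p p. Proof. by []. Qed.

Lemma eq_modX_sym d p q : eq_modX d p q -> eq_modX d q p.
Proof. by move=> h i /h. Qed.

Lemma eq_modX_trans d q p r : eq_modX d p q -> eq_modX d q r -> eq_modX d p r.
Proof. by move=> h1 h2 i lt_id; rewrite h1 ?h2. Qed.

Lemma eq_modXD d p1 p2 q1 q2 :
  eq_modX d p1 p2 -> eq_modX d q1 q2 -> eq_modX d (p1 + q1) (p2 + q2).
Proof. by move=> h1 h2 i lt_id; rewrite !coefD h1 ?h2. Qed.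

Lemma eq_modXM d p1 p2 q1 q2 :
  eq_modX d p1 p2 -> eq_modX d q1 q2 -> eq_modX d (p1 * q1) (p2 * q2).
Proof.
move=> h1 h2 i lt_id; rewrite !coefM; apply: eq_bigr => j _.
rewrite h1 ?h2 //; first by rewrite (leq_ltn_trans (leq_subr _ _)).
by rewrite (leq_trans (ltn_ord j)).
Qed.

Lemma eq_modX_exp d p q n : eq_modX d p q -> eq_modX d (p ^+ n) (q ^+ n).
Proof.
by move=> h; elim: n => [|n IH]; rewrite ?expr0 // !exprS; apply: eq_modXM.
Qed.

Lemma eq_modXS d p q : eq_modX d p q -> eq_modX d.+1 ('X * p) ('X * q).
Proof. by move=> h [|i] lt_id; rewrite !coefXM //= h. Qed.

Lemma eq_modX_deriv d p q : eq_modX d.+1 p q -> eq_modX d p^`() q^`().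
Proof. by move=> h i lt_id; rewrite !coef_deriv h. Qed.

Lemma eq_modXW d d' p q : (d' <= d)%N -> eq_modX d p q -> eq_modX d' p q.
Proof. by move=> le_d h i lt_id; apply: h; apply: leq_trans le_d. Qed.

Lemma eq_modX_expX d p : eq_modX d (('X * p) ^+ d) 0.
Proof. by move=> i lt_id; rewrite exprMn coefXnM lt_id coef0. Qed.

Definition neg_binom (d m : nat) (z : {poly R}) : {poly R} :=
  \sum_(j < d) z ^+ j *+ 'C(m + j - 1, j).

Lemma neg_binomP d m z :
  eq_modX d (z ^+ d) 0 -> eq_modX d (neg_binom d m z * (1 - z) ^+ m) 1.
Proof.
move=> z_nil; elim: m => [|m IH].
  case: d {z_nil} => [|d] //; rewrite /neg_binom big_ord_recl mulr1 big1.
    by rewrite addr0.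
  by move=> i _; rewrite lift0 add0n subn1 bin_small.
rewrite exprS mulrA; apply: eq_modX_trans IH; apply: eq_modXM => //.
case: d z_nil => [|d] z_nil //.
rewrite mulrBr mulr1 /neg_binom [X in X - _]big_ord_recl mulr_suml.
rewrite [X in _ - X]big_ord_recr /= opprD addrA.
rewrite -[X in eq_modX _ _ X]addr0; apply: eq_modXD; last first.
  move=> i lt_i; rewrite coefN mulrnAl -exprSr coefMn z_nil //.
  by rewrite coef0 mul0rn oppr0.
rewrite [X in eq_modX _ _ X]big_ord_recl /= -addrA !addn0 !bin0.
apply: eq_modXD => // i _; congr (nth _ (polyseq _) _).
rewrite -sumrB; apply: eq_bigr => j _.
rewrite /bump /= !add1n mulrnAl -exprSr.
rewrite (_ : (m.+1 + j.+1 - 1 = (m + j).+1)%N); last by lia.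
rewrite (_ : (m.+1 + j - 1 = m + j)%N); last by lia.
rewrite (_ : (m + j.+1 - 1 = m + j)%N); last by lia.
by rewrite binS mulrnDr addrK.
Qed.
End Truncation.

Section TernarySeries.
Variable d : nat.

Definition Bser (p : nat) : {poly rat} := \poly_(i < d) (beta i p)%:R.

Lemma coef_Bser p i : (i < d)%N -> (Bser p)`_i = (beta i p)%:R.
Proof. by move=> lt_id; rewrite coef_poly lt_id. Qed.

Lemma Bser0 : eq_modX d (Bser 0) 1.
Proof. by move=> [|i] lt_i; rewrite coef_Bser // coef1 // beta_p0. Qed.

Lemma BserS p : eq_modX d (Bser p.+1) (Bser p + 'X * Bser p.+3).
Proof.
move=> [|i] lt_i; rewrite coefD coefXM /= !coef_Bser ?addr0 //; last exact: ltnW.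
by rewrite betaS natrD.
Qed.

Lemma BserD p q : eq_modX d (Bser p * Bser q) (Bser (p + q)).
Proof.
suff H i : (i <= d)%N -> forall p, eq_modX i (Bser p * Bser q) (Bser (p + q)).
  exact: H.
elim: i => [|i IHi] // lt_id {}p; elim: p => [|p IHp].
  rewrite -[X in eq_modX _ _ X]mul1r; apply: eq_modXM => //.
  exact: eq_modXW lt_id Bser0.
apply: (@eq_modX_trans _ _ ((Bser p + 'X * Bser p.+3) * Bser q)).
  by apply: eq_modXM => //; apply: eq_modXW lt_id (BserS p).
rewrite mulrDl -mulrA addSn; apply: eq_modX_trans; last first.
  exact: eq_modX_sym (eq_modXW lt_id (BserS _)).
by apply: eq_modXD => //; apply: eq_modXS; apply: IHi; apply: ltnW.
Qed.

Lemma Bser_exp p : eq_modX d (Bser 1 ^+ p) (Bser p).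
Proof.
elim: p => [|p IH]; first by rewrite expr0; apply/eq_modX_sym/Bser0.
rewrite exprSr; apply: eq_modX_trans (eq_modXM IH (@eq_modX_refl _ _ _)) _.
by have := BserD p 1; rewrite addn1.
Qed.

Definition rooted_ser : {poly rat} := \poly_(i < d) (i.+1 * beta i 1)%:R.

Lemma rooted_serE : rooted_ser = ('X * Bser 1)^`().
Proof.
apply/polyP => i; rewrite coef_deriv coefXM /= !coef_poly.
by case: ifP; rewrite ?mul0rn // natrM mulr_natl.
Qed.

Lemma rooted_ser_eq :
  eq_modX d (rooted_ser * (1 - 'X * (Bser 1 ^+ 2 *+ 3))) (2%:P - Bser 1).
Proof.
have B_eq : eq_modX d (Bser 1) (1 + 'X * Bser 1 ^+ 3).
  apply: eq_modX_trans (BserS 0) _; apply: eq_modXD; first exact: Bser0.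
  apply: (eq_modXW (leqnSn d)); apply: eq_modXS; exact/eq_modX_sym/Bser_exp.
have := eq_modX_deriv (eq_modXS B_eq); rewrite -rooted_serE.
have -> : ('X * (1 + 'X * Bser 1 ^+ 3))^`() =
    1 - 'X * Bser 1 ^+ 3 + rooted_ser * ('X * (Bser 1 ^+ 2 *+ 3)).
  rewrite rooted_serE !derivE; ring.
move=> E; rewrite mulrBr mulr1.
rewrite (_ : 2%:P - Bser 1 =
  (2%:P - Bser 1 + rooted_ser * ('X * (Bser 1 ^+ 2 *+ 3)))
    - rooted_ser * ('X * (Bser 1 ^+ 2 *+ 3))); last by rewrite addrK.
apply: eq_modXD => //; apply: eq_modX_trans E _; apply: eq_modXD => // i lt_i.
have := B_eq i lt_i; rewrite !coefB coefD !coef1 => ->; rewrite coefC.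
by case: (i == _) => /=; ring.
Qed.
End TernarySeries.

Lemma coef_rooted_ser_exp d m N : (N < d)%N ->
  (rooted_ser d ^+ m)`_N =
  \sum_(0 <= k < m.+1) \sum_(0 <= j < N.+1)
    (-1) ^+ k * 'C(m, k)%:R * 'C(m + j - 1, j)%:R * 2 ^+ (m - k) * 3 ^+ j
    * (beta (N - j) (2 * j + k))%:R.
Proof.
move=> lt_Nd; set B := Bser d 1; pose z : {poly rat} := 'X * (B ^+ 2 *+ 3).
have E : eq_modX d (rooted_ser d ^+ m) (neg_binom d m z * (2%:P - B) ^+ m).
  apply: eq_modX_sym; apply: (@eq_modX_trans _ _
      (neg_binom d m z * (rooted_ser d * (1 - z)) ^+ m)).
    by apply: eq_modXM => //; apply/eq_modX_exp/eq_modX_sym/rooted_ser_eq.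
  rewrite exprMn mulrCA -[X in eq_modX _ _ X]mulr1; apply: eq_modXM => //.
  exact/neg_binomP/eq_modX_expX.
rewrite E // exprBn mulr_sumr coef_sum big_mkord; apply: eq_bigr => k _.
pose t (j : nat) : {poly rat} := z ^+ j *+ 'C(m + j - 1, j)
  * (((-1) ^+ k * 2%:P ^+ (m - k) * B ^+ k) *+ 'C(m, k)).
have tE j : t j = ((-1) ^+ k * 'C(m, k)%:R * 'C(m + j - 1, j)%:R
    * 2 ^+ (m - k) * 3 ^+ j)%:P * ('X^j * B ^+ (2 * j + k)).
  rewrite /t /z exprMn -[B ^+ 2 *+ 3]mulr_natl exprMn -exprM exprD !rmorphM !rmorphXn /= polyCN.
  rewrite !polyC_natr -[_ *+ 'C(m, k)]mulr_natl -[_ *+ 'C(_, j)]mulr_natl.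
  move: ('X^j) (B ^+ (2 * j)) (B ^+ k) => x y w; ring.
rewrite /neg_binom mulr_suml -[\sum_(j < d) _](big_mkord xpredT t).
rewrite (big_cat_nat (leq0n N.+1) lt_Nd) /= coefD [X in _ + X]coef_sum.
rewrite [X in _ + X]big_nat [X in _ + X]big1 ?addr0 => [|j]; last first.
  case/andP=> lt_Nj _; rewrite tE coefCM coefXnM lt_Nj mulr0 //.
rewrite coef_sum !big_nat; apply: eq_bigr => j /andP[_]; rewrite ltnS => le_jN.
rewrite tE coefCM coefXnM ltnNge le_jN /= (Bser_exp _ (leq_ltn_trans _ lt_Nd)) ?leq_subr //.
by rewrite coef_Bser // (leq_ltn_trans _ lt_Nd) ?leq_subr.
Qed.

Lemma Sigma_sum n m : (0 < m <= n)%N ->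
  Sigma1 n m + Sigma2 n m = \sum_(0 <= k < m.+1) \sum_(0 <= j < (n - m).+1)
    (-1) ^+ k * 'C(m, k)%:R * 'C(m + j - 1, j)%:R * 2 ^+ (m - k) * 3 ^+ j
    * (beta (n - m - j) (2 * j + k))%:R.
Proof.
case/andP=> m_gt0 le_mn; rewrite /Sigma1 /Sigma2 -big_split /=.
apply: eq_bigr => k _; rewrite big_nat_recr //=; congr (_ + _); last first.
  by rewrite subnn mulr1 -!mulrA (_ : (m + (n - m) - 1 = n - 1)%N) //; lia.
rewrite !big_nat; apply: eq_bigr => j /andP[_ lt_j]; rewrite -!mulrA.
do 5! congr (_ * _); rewrite mulrA.
have [N def_N] : exists N, (n - m - j = N.+1)%N by exists (n - m - j).-1; lia.
have N1 : N.+1%:R != 0 :> rat by rewrite pnatr_eq0.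
have /(congr1 (fun x => x%:R : rat)) := beta_closed N (2 * j + k).
rewrite def_N !natrM => /(canRL (mulKf N1)) ->.
rewrite (_ : (3 * n - 3 * m + k - j - 1 = 3 * N + (2 * j + k) + 2)%N); last by lia.
by rewrite subn1 /=; ring.
Qed.

Lemma psi_comp d : psi ('X : {poly rat}) d.+1 =
  1 + 'X%:P * map_poly polyC ('X * rooted_ser d \Po 'X^2).
Proof.
rewrite /psi mul_polyC; congr (_ + _ *: _).
apply/polyP => i; rewrite coef_map /= coef_comp_poly_Xn // ['X * rooted_ser d in RHS]lock /theta.
rewrite mulr_sumr coef_sum.
rewrite (eq_bigr (fun k : 'I_d.+1 => if i == (2 * k.+1)%N then
  (beta k 1 * omega d.+1 k.+1)%:R%:P else 0)); last first.
  move=> k _; rewrite -scalerAr -exprS coefZ coefXn addn0 addn1.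
  rewrite (_ : ((1 + 2 * k).+1 = 2 * k.+1)%N); last by lia.
  by case: eqP => _; rewrite ?mulr0 // mulr1 polyC_natr.
case: ifP => [/dvdnP[j ->]|ndvd]; last first.
  rewrite polyC0 big1 // => k _; case: eqP => // ik.
  by rewrite ik dvdn_mulr in ndvd.
rewrite mulnK // -lock coefXM; case: j => [|j]; first by rewrite big1 // => k _; case: eqP.
rewrite /= coef_poly; case: ltnP => [lt_jd|le_dj].
  rewrite (bigD1 (inord j)) //= inordK ?ltnS 1?ltnW // mulnC eqxx big1 ?addr0.
    by rewrite /omega ltnS lt_jd mulnC.
  by move=> k /eqP kj; case: eqP => // jk; case: kj; apply: val_inj; rewrite /= inordK; lia.
rewrite big1 // => k _; case: eqP => // jk.
by rewrite /omega ifF ?muln0 //; lia.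
Qed.

Lemma coef_walks n m d : (n <= d)%N -> (0 < m <= n)%N ->
  (walks ('X : {poly rat}) d.+1 (2 * n) [::])`_m =
  1 / m%:R * 'C(2 * n, m - 1)%:R * (Sigma1 n m + Sigma2 n m).
Proof.
move=> le_nd m_bnd; have [m_gt0 le_mn] := andP m_bnd.
have charP : [pchar {poly rat}] =i pred0.
  by move=> p; rewrite pchar_poly pchar_num.
rewrite walksE // Sigma_sum // -(coef_rooted_ser_exp (d := d)); last by lia.
have := lagrange_inversion (psi ('X : {poly rat}) d.+1) charP (2 * n)
  ('X * Pgf 'X d.+1 [::]).
rewrite mulr1; move: (lagr _ _ _) => w; rewrite derivX mul1r psi_comp exprDn.
have -> : (\sum_(i < (2 * n).+2) (1 ^+ ((2 * n).+1 - i) *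
   ('X%:P * map_poly polyC ('X * rooted_ser d \Po 'X^2)) ^+ i) *+ 'C((2 * n).+1, i))`_(2 * n)
   = \sum_(i < (2 * n).+2) 'X^i * ((('X * rooted_ser d) ^+ i)`_n *+ 'C((2 * n).+1, i))%:P
     :> {poly rat}.
  rewrite coef_sum; apply: eq_bigr => i _.
  rewrite expr1n mul1r exprMn coefMn -rmorphXn -rmorphXn /= coefCM.
  rewrite coef_map /= -rmorphXn coef_comp_poly_Xn // dvdn_mulr // mulKn //.
  by rewrite polyCMn mulrnAr.
move=> /(congr1 (fun p : {poly rat} => p`_m)).
have lt_m : (m < (2 * n).+2)%N by lia.
rewrite -polyC_natr coefCM coef_sum (bigD1 (Ordinal lt_m)) //=.
rewrite [X in _ + X]big1 ?addr0 => [|i /eqP im]; last first.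
  rewrite coefXnM coefC; case: ltnP => // le_im; case: eqP => //.
  by move=> mi; case: im; apply: val_inj => /=; lia.
rewrite coefXnM ltnn subnn coefC /= exprMn coefXnM ltnNge le_mn /= => E.
have n1 : (2 * n).+1%:R != 0 :> rat by rewrite pnatr_eq0.
apply: (mulfI n1); rewrite E -[_ *+ 'C(_, _)]mulr_natr subn1.
have m1 : m%:R != 0 :> rat by rewrite pnatr_eq0; lia.
have := mul_bin_diag (2 * n).+1 m.-1; rewrite prednK // => bin_eq.
have -> : 'C((2 * n).+1, m)%:R = (2 * n).+1%:R * 'C(2 * n, m.-1)%:R / m%:R :> rat.
  by rewrite -natrM bin_eq natrM mulrAC divff ?mul1r.
by move: (_`_(n - m)) ('C(_, _)%:R) ((2 * n).+1%:R) => x y z; field.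
Qed.

Local Close Scope ring_scope.

(** * The scanning automaton *)

Section Automaton.
Variable T : finType.

(* Closes the chord opened at a: e lists the open chords of the blocks skipped
   so far and i counts all the chords of these blocks.  The result is None when
   closing a would create a cycle. *)
Fixpoint pop (st : seq (seq T * nat)) (e : seq T) (i : nat) (a : T) :
    option (seq T * nat * seq (seq T * nat)) :=
  if st is (l, j) :: st' then
    if l is b :: l' then
      if b == a then Some (e ++ l', j + i, st')
      else if l' == [::] then pop st' (rcons e b) (j + i) a else None
    else None
  else None.

Definition shape (st : seq (seq T * nat)) : stack :=
  [seq (size x.1, x.2) | x <- st].

Definition opened (A : Type) (st : seq (seq T * A)) : seq T := flatten (unzip1 st).

Lemma pop_perm st e i a l j st' : pop st e i a = Some (l, j, st') ->
  perm_eq (e ++ opened st) (a :: l ++ opened st').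
Proof.
elim: st e i => [|[[|b l0] j0] st IH] e i //=.
case: eqP => [-> [<- _ <-]|_].
  by rewrite /opened /= -catA; apply: (permEl (perm_catCA e [:: a] _)).
case: eqP => // -> /IH; rewrite /opened /=; apply: perm_trans.
by rewrite -cats1 -catA.
Qed.

Lemma pop_None st e i a : a \notin opened st -> pop st e i a = None.
Proof.
elim: st e i => [|[[|b l] j] st IH] e i //=.
rewrite /opened /= inE mem_cat !negb_or => /and3P[ab _ a_st].
by rewrite eq_sym (negPf ab) IH //; case: ifP.
Qed.

Definition proper (st : seq (seq T * nat)) := [::] \notin unzip1 st.

Lemma pop_proper st e i a l j st' :
  pop st e i a = Some (l, j, st') -> proper st -> proper st'.
Proof.
elim: st e i => [|[[|b l0] j0] st IH] e i //=; rewrite /proper inE /=.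
case: eqP => [_ [_ _ <-] //|_]; case: eqP => // _; exact: IH.
Qed.

Section Runs.
Variables (K : idomainType) (u : K) (M : nat).
Local Open Scope ring_scope.

Definition weight (j : nat) : K := u * (omega M j)%:R.

Definition popped (F : seq (seq T * nat) -> K)
    (o : option (seq T * nat * seq (seq T * nat))) : K :=
  if o is Some (l, j, st) then
    if l == [::] then weight j * F st else F ((l, j) :: st)
  else 0.

Fixpoint run (ts : seq T) (w : seq (option T)) (st : seq (seq T * nat)) : K :=
  if ts is t :: ts' then
    if w is x :: w' then
      if x is Some a then popped (run ts' w') (pop st [::] 0 a)
      else run ts' w' (([:: t], 1%N) :: st)
    else 0
  else (st == [::])%:R.

Lemma sum_popped (G : stack -> K) st e i : uniq (opened st) -> proper st ->
  \sum_a popped (fun st => G (shape st)) (pop st e i a) =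
  \sum_(cs <- closings u M (shape st) (size e) i) cs.1 * G cs.2.
Proof.
elim: st e i => [|[[|b l] j] st IH] e i //=.
  by move=> _ _; rewrite big_nil big1.
rewrite /opened /proper inE /= mem_cat negb_or => /andP[/andP[b_l b_st]].
rewrite cat_uniq => /and3P[_ _ uniq_st] proper_st.
rewrite big_cons (bigD1 b) //= eqxx; congr (_ + _).
  have -> : ((size l + size e)%N == 0%N) = (e ++ l == [::]).
    by rewrite -(size_eq0 (e ++ l)) size_cat addnC.
  rewrite /popped; case: ifP => _ //=.
  by rewrite mul1r size_cat (addnC (size e)).
rewrite eqSS size_eq0; case: eqP => [l_nil|_]; last first.
  rewrite big_nil big1 // => a; rewrite eq_sym => /negPf ->.
  by [].
rewrite -(size_rcons e b) -IH // [RHS](bigD1 b) //= pop_None //= add0r.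
by apply: eq_bigr => a; rewrite eq_sym => /negPf ->.
Qed.

Lemma big_tuple_cons k (F : seq (option T) -> K) :
  \sum_(w : k.+1.-tuple (option T)) F w =
  \sum_x \sum_(w : k.-tuple (option T)) F (x :: w).
Proof.
rewrite pair_bigA (reindex (fun p : option T * k.-tuple (option T) => [tuple of p.1 :: p.2])) //=.
exists (fun w => (thead w, [tuple of behead w])) => [[x w] _|w _] /=.
  by rewrite theadE; congr pair; apply: val_inj.
by rewrite [RHS]tuple_eta.
Qed.

Lemma sum_run ts st : uniq (ts ++ opened st) -> proper st ->
  \sum_(w : (size ts).-tuple (option T)) run ts w st =
  walks u M (size ts) (shape st).
Proof.
elim: ts st => [|t ts IH] st.
  move=> _ _; rewrite (big_pred1 [tuple]) => [|w]; last first.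
    by apply/esym/eqP/tuple0.
  by case: st.
rewrite cat_cons cons_uniq => /andP[t_ts uniq_st] proper_st.
rewrite (big_tuple_cons _ (fun w => run (t :: ts) w st)) (bigD1 None) //=; congr (_ + _).
  rewrite IH //; rewrite /opened /=.
  by rewrite -cat1s uniq_catCA /= t_ts.
rewrite -(sum_popped _ [::]); [|by rewrite cat_uniq in uniq_st; case/and3P: uniq_st|by []].
rewrite (reindex_omap Some id) /=; last by case.
rewrite (eq_bigl xpredT) => [|a]; last by rewrite eqxx.
apply: eq_bigr => a _; case E: (pop st [::] 0 a) => [[[l j] st']|] /=; last first.
  by rewrite big1.
have /= perm_st := pop_perm E.
have proper_st' := pop_proper E proper_st.
have uniq_st' : uniq (ts ++ l ++ opened st').
  move: uniq_st; rewrite (perm_uniq (_ : perm_eq _ (ts ++ a :: l ++ opened st'))).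
    by rewrite -cat1s uniq_catCA cons_uniq => /andP[].
  by rewrite perm_cat2l.
case: eqP => [l_nil|l_nil].
  by rewrite l_nil in uniq_st'; rewrite -mulr_sumr IH.
rewrite IH // /proper inE negb_or eq_sym; apply/andP; split=> //; exact/eqP.
Qed.
Lemma run_perm ts (w : T -> option T) st : run ts (map w ts) st != 0 ->
  perm_eq (pmap w ts) (opened st ++ [seq t <- ts | w t == None]).
Proof.
elim: ts st => [|t ts IH] st /=; first by case: st => //=; rewrite eqxx.
case: (w t) => [a|] /=; last first.
  move/IH; rewrite /opened /= => /perm_trans; apply.
  by rewrite -cat1s -[t :: filter _ _]cat1s; apply/permEl/perm_catCA.
case E: (pop st [::] 0 a) => [[[l j] st']|] /=; last by rewrite eqxx.
have /= perm_st := pop_perm E.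
suff H : perm_eq (pmap w ts) ((l ++ opened st') ++ [seq t <- ts | w t == None]) ->
    perm_eq (a :: pmap w ts) (opened st ++ [seq t <- ts | w t == None]).
  case: (l =P [::]) => [l_nil|_].
    by rewrite l_nil in H; rewrite mulf_eq0 negb_or => /andP[_ /IH].
  by move/IH.
move=> perm_w; apply: perm_trans (_ : perm_eq _ ((a :: l ++ opened st') ++ _)) _.
  by rewrite cat_cons perm_cons; apply: perm_w.
by rewrite perm_cat2r perm_sym.
Qed.

Lemma run_closes_opened (lt : rel T) ts (w : T -> option T) st :
  pairwise lt ts -> allrel lt (opened st) ts -> run ts (map w ts) st != 0 ->
  {in ts, forall t a, w t = Some a -> lt a t}.
Proof.
elim: ts st => [|t ts IH] st //=.
case/andP=> lt_t pair_ts; rewrite allrel_consr => /andP[lt_st st_ts] nz.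
have aux st' : {subset opened st' <= t :: opened st} ->
    run ts (map w ts) st' != 0 -> {in ts, forall t a, w t = Some a -> lt a t}.
  move=> sub; apply: IH => //; apply/allrelP => x y /sub.
  rewrite inE => /predU1P[->|x_st] y_ts; first exact: (allP lt_t).
  exact: (allrelP st_ts).
move=> x; rewrite inE => /predU1P[->|x_ts] a wa; move: nz.
  rewrite wa; case E: (pop st [::] 0 a) => [[[l j] st']|] /=; last by rewrite eqxx.
  move=> _; apply: (allP lt_st); rewrite (perm_mem (pop_perm E)).
  exact: mem_head.
case: (w t) => [b|]; last first.
  move=> nz; apply: (aux _ _ nz x x_ts a wa) => y.
  by rewrite /opened /=.
case E: (pop st [::] 0 b) => [[[l j] st']|] /=; last by rewrite eqxx.
have sub : {subset l ++ opened st' <= t :: opened st}.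
  by move=> y yl; rewrite inE (perm_mem (pop_perm E)) inE yl !orbT.
case: (l =P [::]) => [l_nil|_] nz.
  move: nz; rewrite mulf_eq0 negb_or => /andP[_ nz].
  by apply: (aux _ _ nz x x_ts a wa); rewrite l_nil in sub.
exact: (aux ((l, j) :: st') sub nz x x_ts a wa).
Qed.
End Runs.
End Automaton.

Lemma uniq_map_inj (T1 T2 : eqType) (g : T1 -> T2) (s : seq T1) :
  uniq (map g s) -> {in s &, injective g}.
Proof.
elim: s => [|z s IH] //= /andP[gz /IH inj_g] x y.
rewrite !inE => /predU1P[->|xs] /predU1P[->|ys] gxy //.
- by rewrite gxy map_f in gz.
- by rewrite -gxy map_f in gz.
- exact: inj_g.
Qed.

Section Involution.
Variables (N : nat) (f : 'I_N -> 'I_N).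
Hypotheses (fK : involutive f) (f_neq : forall x, f x != x).

(* A chord {x, f x} is represented by its smaller endpoint. *)
Definition letter (t : 'I_N) : option 'I_N := if f t < t then Some (f t) else None.

Definition arc_cross : rel 'I_N := fun x y =>
  [&& x < f x, y < f y &
    [&& x < y, y < f x & f x < f y] || [&& y < x, x < f y & f y < f x]].

(* The crossings that are determined by the points before t. *)
Definition edge (t : nat) : rel 'I_N := fun x y =>
  arc_cross x y && (minn (f x) (f y) < t).

Local Notation gstate := (seq (seq 'I_N * {set 'I_N})).

Definition idst (gst : gstate) : seq (seq 'I_N * nat) :=
  [seq (x.1, #|x.2|) | x : seq 'I_N * {set 'I_N} <- gst].

Definition descending := pairwise (fun x y : 'I_N => y < x).

Lemma pop_split (gst : gstate) e i a l j st' :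
  pop (idst gst) e i a = Some (l, j, st') ->
  exists g1 l' K g2,
    [/\ gst = g1 ++ (a :: l', K) :: g2, {in g1, forall x, size x.1 = 1},
        l = e ++ opened g1 ++ l', j = \sum_(x <- g1) #|x.2| + #|K| + i
      & st' = idst g2].
Proof.
elim: gst e i => [|[[|b l0] K0] gst IH] e i //=.
case: eqP => [-> [<- <- <-]|_].
  by exists [::], l0, K0, gst; split=> //; rewrite big_nil add0n.
case: eqP => // -> /IH[g1 [l' [K [g2 [-> g1_1 -> -> ->]]]]].
exists (([:: b], K0) :: g1), l', K, g2; split=> //.
- by move=> x; rewrite inE => /predU1P[->|/g1_1].
- by rewrite -cats1 -catA /opened.
- by rewrite big_cons /=; lia.
Qed.

Lemma pop_fail (gst : gstate) e i a : descending (opened gst) ->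
  [::] \notin unzip1 gst -> a \in opened gst -> pop (idst gst) e i a = None ->
  exists x b c, [/\ x \in gst, b != c, b \in x.1 & c \in x.1] /\ (a <= b) && (a <= c).
Proof.
elim: gst e i => [|[[|b l0] K0] gst IH] e i //=; rewrite /opened /=.
rewrite -/(opened gst) => /andP[all_b desc]; rewrite inE /= => ne.
case: eqP => // b_neq_a.
rewrite inE mem_cat eq_sym; case/predU1P=> [//|].
case: eqP => [l_nil|/eqP l_nil].
  rewrite l_nil /= in desc * => a_gst /(IH _ _ desc ne a_gst)[x [c [d [[xg cd cx dx] acd]]]].
  by exists x, c, d; rewrite inE xg orbT.
case: l0 l_nil all_b desc => // c l0 _ /= /andP[lt_cb all_b] /andP[all_c desc] a_in _.
exists (b :: c :: l0, K0), b.
have [a_l|a_l] := boolP (a \in c :: l0).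
  exists a; rewrite !inE !eqxx /=; move: a_l; rewrite inE => a_l.
  have lt_ab : a < b.
    by case/predU1P: a_l => [->|a_l] //; apply: (allP all_b); rewrite mem_cat a_l.
  rewrite leqnn ltnW // a_l orbT; split=> //; split=> //; exact/eqP.
rewrite (negPf a_l) /= in a_in.
have lt_ac : a < c by apply: (allP all_c); rewrite mem_cat a_in orbT.
exists c; rewrite !inE !eqxx !orbT /=; split; last by lia.
by split=> //; apply: contraTneq lt_cb => ->; rewrite ltnn.
Qed.

Lemma edge_sym t : symmetric (edge t).
Proof.
move=> x y; rewrite /edge /arc_cross minnC andbCA; congr (_ && _); congr (_ && _).
by rewrite orbC.
Qed.

(* gst pairs the open chords of each unfinished component with the set of all
   its chords, and fin lists the finished components. *)
Record inv (t : nat) (gst : gstate) (fin : seq {set 'I_N}) : Prop := Inv {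
  inv_desc : descending (opened gst);
  inv_mem : forall x : 'I_N, (x \in opened gst) = (x < t) && (t <= f x);
  inv_proper : [::] \notin unzip1 gst;
  inv_comps : is_comps (edge t) (unzip2 gst ++ fin)
                (fun x : 'I_N => (x < f x) && (x < t));
  inv_sub : forall b x, b \in gst -> x \in b.1 -> x \in b.2;
  inv_acyclic : acyclic (edge t) }.

Lemma edge_open (t : 'I_N) : t < f t -> edge t.+1 =2 edge t.
Proof.
move=> lt_t x y; rewrite /edge; apply: andb_id2l.
rewrite /arc_cross => /and3P[xf yf _].
have xt : f x <> t :> nat by move=> /val_inj xt; move: lt_t xf; rewrite -xt fK; lia.
have yt : f y <> t :> nat by move=> /val_inj yt; move: lt_t yf; rewrite -yt fK; lia.
lia.
Qed.

Lemma inv_open (t : 'I_N) gst fin : t < f t -> inv t gst fin ->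
  inv t.+1 (([:: t], [set t]) :: gst) fin.
Proof.
move=> lt_t [desc mem ne comps sub acy].
have f_eq_t (x : 'I_N) : f x = t :> nat -> t < x.
  by move=> /val_inj E; rewrite -(fK x) E.
split=> //.
- rewrite /descending /opened /=; apply/andP; split=> //.
  by apply/allP => x; rewrite mem => /andP[].
- move=> x; rewrite /opened /= inE -/(opened gst) mem.
  have [->|x_t] := eqVneq x t; first by rewrite ltnSn lt_t.
  have : val x <> val t by move=> /val_inj E; rewrite E eqxx in x_t.
  have := f_eq_t x.
  rewrite /=; lia.
- apply: (@eq_is_comps _ (edge t)); first by move=> x y; rewrite edge_open.
    by move=> x; reflexivity.
  have [cnt nes con clo] := comps; split.
  + move=> x /=; rewrite cnt inE; have [->|x_t] := eqVneq x t.
      by rewrite ltnn ltnSn lt_t.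
    have : val x <> val t by move=> /val_inj E; rewrite E eqxx in x_t.
    move=> /= x_neq; congr (nat_of_bool (_ && _)); lia.
  + rewrite /= inE negb_or nes andbT; apply/eqP => /setP/(_ t).
    by rewrite !inE eqxx.
  + move=> K; rewrite inE => /predU1P[->|KK]; last exact: con.
    by move=> x y; rewrite !inE => /eqP -> /eqP ->.
  + move=> K; rewrite inE => /predU1P[->|KK]; last exact: clo.
    move=> x y; rewrite !inE => /eqP -> /andP[/and3P[_ _ cr] mn].
    exfalso; lia.
- move=> b x; rewrite inE => /predU1P[->|]; last exact: sub.
  by rewrite /= !inE.
- by apply: sub_acyclic acy => x y; rewrite edge_open.
Qed.

Lemma edge_close (t : 'I_N) (S : seq 'I_N) : f t < t ->
  (forall y : 'I_N, (y \in S) = [&& f t < y, y < t & t <= f y]) ->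
  edge t.+1 =2 add_star (edge t) (f t) S.
Proof.
move=> lt_t mem_S x y; rewrite add_starE !mem_S /edge /arc_cross.
have f_eq_t (z : 'I_N) : (f z == t :> nat) = (z == f t).
  by rewrite val_eqE; apply/eqP/eqP => [<-|->]; rewrite fK.
have := f_eq_t x; have := f_eq_t y.
have [->|x_a] := eqVneq x (f t); have [->|y_a] := eqVneq y (f t); rewrite ?fK; lia.
Qed.

Lemma inv_close (t : 'I_N) gst fin g1 l' (K : {set 'I_N}) g2 :
  f t < t -> inv t gst fin -> gst = g1 ++ (f t :: l', K) :: g2 ->
  {in g1, forall x, size x.1 = 1} ->
  let U := \bigcup_(L <- K :: unzip2 g1) L in let l := opened g1 ++ l' in
  #|U| = \sum_(x <- g1) #|x.2| + #|K| /\
  inv t.+1 (if l == [::] then g2 else (l, U) :: g2)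
           (if l == [::] then U :: fin else fin).
Proof.
move=> lt_t [desc mem ne comps sub acy] def_gst g1_1 U l.
set a := f t in def_gst *.
have opened_gst : opened gst = opened g1 ++ (a :: l') ++ opened g2.
  by rewrite def_gst /opened /unzip1 map_cat flatten_cat.
have sub_new : subseq (l ++ opened g2) (opened gst).
  rewrite opened_gst -catA; apply: cat_subseq => //=; exact: subseq_cons.
have mem_gst x : (x \in opened gst) = (x == a) || (x \in l ++ opened g2).
  by rewrite opened_gst !mem_cat inE -!orbA orbCA.
have a_new : a \notin l ++ opened g2.
  have : uniq (opened gst).
    rewrite uniq_pairwise; apply: sub_pairwise desc => x y /=.
    by apply: contraTneq => ->; rewrite ltnn.
  by rewrite opened_gst -cat1s -catA uniq_catCA /= -catA => /andP[].
have f_eq_t (z : 'I_N) : (f z == t :> nat) = (z == a).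
  by rewrite /a val_eqE; apply/eqP/eqP => [<-|->]; rewrite fK.
have mem_new (x : 'I_N) : (x \in l ++ opened g2) = (x < t.+1) && (t.+1 <= f x).
  have := mem x; rewrite mem_gst; have := f_eq_t x.
  have [->|x_a] := eqVneq x a; first by rewrite (negPf a_new) /= /a fK; lia.
  rewrite /= => ft ->; have [->|x_t] := eqVneq x t; first by lia.
  have : val x <> val t by move=> /val_inj E; rewrite E eqxx in x_t.
  move=> /=; lia.
have mem_S (y : 'I_N) : (y \in opened g1) = [&& a < y, y < t & t <= f y].
  rewrite -mem opened_gst !mem_cat.
  move: desc; rewrite opened_gst /descending pairwise_cat allrel_consr.
  case/and3P=> /andP[/allP gt_a _] _ /= /andP[/allP lt_a _].
  case y1: (y \in opened g1); first by rewrite (gt_a y y1).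
  rewrite inE -orbA -mem_cat; case: eqP => [->|_]; first by rewrite ltnn.
  case y2: (y \in l' ++ opened g2); last by rewrite andbF.
  have := lt_a y y2; lia.
have edgeE := edge_close lt_t mem_S.
have comps1 : is_comps (edge t) (K :: unzip2 g1 ++ unzip2 g2 ++ fin)
    (fun x : 'I_N => (x < f x) && (x < t)).
  apply: is_comps_perm comps; rewrite def_gst /unzip2 map_cat /= -catA /=.
  by rewrite -cat1s -[K :: (_ ++ _)]cat1s; apply/permEl/perm_catCA.
have aK : a \in K.
  by apply: (sub (a :: l', K)); rewrite ?mem_head // def_gst mem_cat mem_head orbT.
have sub1 x y : x \in g1 -> y \in x.1 -> y \in x.2.
  by move=> xg; apply: sub; rewrite def_gst mem_cat xg.
have comps2 : is_comps (edge t.+1) (U :: unzip2 g2 ++ fin)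
    (fun x : 'I_N => (x < f x) && (x < t.+1)).
  apply: (@eq_is_comps _ (add_star (edge t) a (opened g1)) _ _
            (fun x : 'I_N => (x < f x) && (x < t))).
  - by move=> x y; rewrite -edgeE.
  - move=> x; have [->|x_t] := eqVneq x t; first by lia.
    have : val x <> val t by move=> /val_inj E; rewrite E eqxx in x_t.
    move=> /=; lia.
  apply: add_star_comps => //; first exact: edge_sym.
  - move=> L /mapP[[[|s [|s' sl]] L'] xg ->]; have := g1_1 _ xg => //= _.
    exists s; last by apply: (sub1 _ _ xg); rewrite mem_head.
    by apply/flattenP; exists [:: s]; [apply/mapP; exists ([:: s], L')|rewrite mem_head].
  - move=> s /flattenP[b /mapP[x xg ->] sx]; exists x.2; last exact: sub1 sx.
    exact: map_f.
have [uniq1 _] := is_comps_partition comps1.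
split.
  rewrite /U card_bigcup_seq ?big_cons ?big_map 1?addnC // => x.
  have [cnt _ _ _] := comps1; have := cnt x; rewrite -cat_cons count_cat.
  move=> E; apply: (leq_trans (leq_addr
    (count (fun L : {set 'I_N} => x \in L) (unzip2 g2 ++ fin)) _)).
  by rewrite E; case: (_ && _).
have acy' : acyclic (edge t.+1).
  apply: (@sub_acyclic _ (add_star (edge t) a (opened g1))).
    by move=> x y; rewrite edgeE.
  apply: add_star_acyclic => //.
  pose G := ([:: a], K) :: g1.
  have blockP x : x \in a :: opened g1 -> exists2 X, X \in G & X.1 = [:: x].
    rewrite inE => /predU1P[->|]; first by exists ([:: a], K); rewrite ?mem_head.
    case/flattenP=> b /mapP[X Xg ->] xX; exists X; first by rewrite inE Xg orbT.
    have := g1_1 X Xg; case: (X.1) xX => [|z [|]] //.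
    by rewrite inE => /eqP ->.
  have subG X x : X \in G -> X.1 = [:: x] -> x \in X.2.
    rewrite inE => /predU1P[-> [<-] //|Xg X1]; apply: sub1 => //.
    by rewrite X1 mem_head.
  have G_comp X : X \in G -> X.2 \in K :: unzip2 g1 ++ unzip2 g2 ++ fin.
    by move=> XG; rewrite -cat_cons mem_cat (map_f snd XG : X.2 \in K :: unzip2 g1).
  have injG : {in G &, injective snd}.
    by apply: uniq_map_inj; move: uniq1; rewrite -cat_cons cat_uniq => /andP[].
  move=> x y /blockP[X XG X1] /blockP[Y YG Y1]; apply: contraNN => con.
  have yX : y \in X.2.
    exact: is_comps_connect comps1 (G_comp X XG) (subG X x XG X1) con.
  have XY := is_comps_inj comps1 (G_comp X XG) (G_comp Y YG) yX (subG Y y YG Y1).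
  by move: X1; rewrite (injG X Y XG YG XY) Y1 => -[->].
have desc' : descending (l ++ opened g2) by apply: subseq_pairwise sub_new desc.
have ne2 : [::] \notin unzip1 g2.
  by apply: contraNN ne; rewrite def_gst /unzip1 map_cat mem_cat inE => ->; rewrite !orbT.
have sub2 b x : b \in g2 -> x \in b.1 -> x \in b.2.
  by move=> bg; apply: sub; rewrite def_gst mem_cat inE bg !orbT.
case: (l =P [::]) => [l_nil|/eqP l_nil].
  rewrite l_nil /= in desc' mem_new; split=> //.
  apply: is_comps_perm comps2; rewrite -cat1s -[U :: fin]cat1s.
  exact/permEl/perm_catCA.
split=> //.
  by rewrite /= inE negb_or eq_sym l_nil.
move=> b x; rewrite inE => /predU1P[->|]; last exact: sub2.
rewrite /= mem_cat mem_bigcup_seq /=; case/orP => [|xl'].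
  case/flattenP=> b1 /mapP[X Xg ->] xX; apply/orP; right; apply/hasP.
  by exists X.2; [apply: map_f|apply: sub1 xX].
apply/orP; left; apply: (sub (a :: l', K)); last by rewrite inE xl' orbT.
by rewrite def_gst mem_cat mem_head orbT.
Qed.
Lemma pop_cyclic (t : 'I_N) gst fin : f t < t -> inv t gst fin ->
  pop (idst gst) [::] 0 (f t) = None -> ~~ acyclic arc_cross.
Proof.
move=> lt_t [desc mem ne comps sub _] pop_t.
have a_gst : f t \in opened gst by rewrite mem fK lt_t /=.
have [X [b [c [[Xg bc bX cX] /andP[ab ac]]]]] := pop_fail desc ne a_gst pop_t.
pose S := [seq y : 'I_N <- opened gst | f t < y].
have mem_S (y : 'I_N) : (y \in S) = [&& f t < y, y < t & t <= f y].
  by rewrite mem_filter mem.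
have inS (y : 'I_N) : f t <= y -> y \in X.1 -> y \in f t :: S.
  move=> ay yX; have y_gst : y \in opened gst.
    by apply/flattenP; exists X.1 => //; apply: map_f.
  rewrite inE mem_filter y_gst andbT ltn_neqAle ay andbT eq_sym.
  by rewrite -val_eqE orbN.
have cyc : ~~ acyclic (edge t.+1).
  apply: contraNN (@add_star_cyclic _ (edge t) (f t) S (edge_sym t) b c _ _ _ _ bc _).
  - by apply: sub_acyclic => x y; rewrite (edge_close lt_t mem_S).
  - by move=> s; rewrite mem_S /edge fK; lia.
  - by rewrite mem_S ltnn.
  - exact: inS.
  - exact: inS.
  - case: comps => _ _ con _; apply: (con X.2); try exact: sub.
    by rewrite mem_cat map_f.
by apply: contraNN cyc; apply: sub_acyclic => x y /andP[].
Qed.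

Section Weights.
Variables (K : idomainType) (u : K) (M : nat).
Local Open Scope ring_scope.

Definition comp_weight (Ks : seq {set 'I_N}) : K :=
  \prod_(L <- Ks) weight u M #|L|.

Lemma comp_weight_cons L Ks :
  comp_weight (L :: Ks) = weight u M #|L| * comp_weight Ks.
Proof. by rewrite /comp_weight big_cons. Qed.

Lemma run_inv (ts : seq 'I_N) t gst fin :
  map val ts = iota t (size ts) -> (t + size ts = N)%N -> inv t gst fin ->
  (acyclic arc_cross /\ exists Ks,
     is_comps arc_cross Ks (fun x : 'I_N => x < f x)%N /\
     run u M ts (map letter ts) (idst gst) * comp_weight fin = comp_weight Ks)
  \/ (~~ acyclic arc_cross /\ run u M ts (map letter ts) (idst gst) = 0).
Proof.
elim: ts t gst fin => [|x ts IH] t gst fin /=.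
  rewrite addn0 => _ {t}-> inv_t; have [_ mem ne comps _ acy] := inv_t.
  have edgeE : edge N =2 arc_cross.
    by move=> x y; rewrite /edge (leq_ltn_trans (geq_minl _ _) (ltn_ord _)) andbT.
  have gst_nil : gst = [::].
    case: gst ne mem {comps inv_t} => [|[[|y l] L] gst] //= _ /(_ y).
    by rewrite /opened /= mem_head ltn_ord /= leqNgt ltn_ord.
  left; split; first by apply: sub_acyclic acy => x y; rewrite edgeE.
  exists fin; split; last by rewrite gst_nil mul1r.
  rewrite gst_nil in comps; apply: eq_is_comps comps; first exact: edgeE.
  by move=> x; rewrite ltn_ord andbT.
case=> def_t def_ts szN inv_t; rewrite -def_t in inv_t def_ts szN.
have {}szN : (x.+1 + size ts = N)%N by rewrite addSnnS.
have [lt_x|lt_x|/val_inj E] := ltngtP (f x) x; last first.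
- by have := f_neq x; rewrite E eqxx.
- have -> : letter x = None by rewrite /letter ltnNge ltnW.
  have := IH _ _ _ def_ts szN (inv_open lt_x inv_t).
  by rewrite /= cards1.
have -> : letter x = Some (f x) by rewrite /letter lt_x.
case pop_x: (pop (idst gst) [::] 0 (f x)) => [[[l j] st']|]; last first.
  by right; split=> //; apply: pop_cyclic lt_x inv_t pop_x.
have [g1 [l' [L [g2 [def_gst g1_1 def_l def_j def_st]]]]] := pop_split pop_x.
have [cardU] := inv_close lt_x inv_t def_gst g1_1.
rewrite /= in def_l; rewrite -def_l /= def_st def_j addn0 -cardU.
case: (l =P [::]) => [_|_] inv_t'; have := IH _ _ _ def_ts szN inv_t'; last by [].
move=> -[[acy [Ks [comps E]]]|[cyc E]]; [left|right].
  split=> //; exists Ks; split=> //; rewrite -E comp_weight_cons.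
  by rewrite [RHS]mulrCA mulrA.
by split=> //; rewrite E mulr0.
Qed.

Lemma run_letters :
  (acyclic arc_cross /\ exists Ks,
     is_comps arc_cross Ks (fun x : 'I_N => x < f x)%N /\
     run u M (enum 'I_N) (map letter (enum 'I_N)) [::] = comp_weight Ks)
  \/ (~~ acyclic arc_cross /\
       run u M (enum 'I_N) (map letter (enum 'I_N)) [::] = 0).
Proof.
have inv0 : inv 0 [::] [::].
  split; [by []|by move=> x; rewrite in_nil|by []| |by []|].
    by split=> [x|//|L|L] //=; rewrite andbF.
  by apply/acyclicP => -[|y [|z p]] //= _ /andP[/= /andP[/andP[]]].
have map_enum : map val (enum 'I_N) = iota 0 (size (enum 'I_N)).
  by rewrite val_enum_ord size_enum_ord.
have sz : (0 + size (enum 'I_N) = N)%N by rewrite size_enum_ord.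
have [[acy [Ks [comps E]]]|] := run_inv map_enum sz inv0; last by right.
by left; split=> //; exists Ks; split=> //; rewrite -E /comp_weight big_nil mulr1.
Qed.
End Weights.
End Involution.

(** * Chord diagrams as words *)

Section Transport.
Variables (V1 V2 : finType) (ch : V1 -> V2) (e1 : rel V1) (e2 : rel V2).
Variables (D1 : pred V1) (D2 : pred V2).
Hypothesis ch_inj : {in D1 &, injective ch}.
Hypothesis D2P : forall A, reflect (exists2 x, D1 x & A = ch x) (D2 A).
Hypothesis e1_D1 : forall x y, e1 x y -> D1 x && D1 y.
Hypothesis e2_D2 : forall A B, e2 A B -> D2 A && D2 B.
Hypothesis ch_mono : {in D1 &, forall x y, e2 (ch x) (ch y) = e1 x y}.

Lemma ch_homo x y : e1 x y -> e2 (ch x) (ch y).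
Proof. by move=> xy; have /andP[x1 y1] := e1_D1 xy; rewrite ch_mono. Qed.

Lemma acyclic_transport : acyclic e1 = acyclic e2.
Proof.
apply/acyclicP/acyclicP => acy p p_gt2 /andP[cyc uniq_p].
  have [q all_q def_p] : exists2 q, all D1 q & p = map ch q.
    have : all D2 p by apply/allP=> A Ap; have /e2_D2/andP[] := next_cycle cyc Ap.
    elim: p {cyc uniq_p p_gt2} => [|A p IH] /=; first by exists [::].
    case/andP=> /D2P[x x1 ->] /IH[q q1 ->]; exists (x :: q) => //=.
    by rewrite q1 andbT.
  rewrite def_p size_map in cyc uniq_p p_gt2.
  apply: (acy q p_gt2); rewrite /ucycle (map_uniq uniq_p) andbT.
  rewrite cycle_map in cyc; apply: sub_in_cycle all_q cyc => x y x1 y1 /=.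
  by rewrite ch_mono.
have p1 x : x \in p -> D1 x by move/(next_cycle cyc)/e1_D1/andP => [].
apply: (acy (map ch p)); rewrite ?size_map // /ucycle map_inj_in_uniq.
  by rewrite uniq_p andbT; apply: homo_cycle cyc; apply: ch_homo.
by move=> x y /p1 x1 /p1 y1; apply: ch_inj.
Qed.

Lemma is_comps_transport Ks : is_comps e1 Ks D1 ->
  is_comps e2 [seq ch @: (K : {set V1}) | K <- Ks] D2.
Proof.
move=> cK; have [cnt ne con clo] := cK.
have K1 K x : K \in Ks -> x \in K -> D1 x.
  by move=> KK xK; rewrite (is_comps_mem x cK); apply/hasP; exists K.
have mem_ch K x : K \in Ks -> D1 x -> (ch x \in ch @: (K : {set V1})) = (x \in K).
  move=> KK x1; apply/imsetP/idP => [[y yK /ch_inj ->] //|xK]; last by exists x.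
  exact: K1 yK.
have connect_ch x y : connect e1 x y -> connect e2 (ch x) (ch y).
  case/connectP=> p; elim: p x => [|z p IH] x /=; first by move=> _ ->; apply: connect0.
  case/andP=> xz path_p last_p; apply: connect_trans (IH z path_p last_p).
  exact/connect1/ch_homo.
split.
- move=> A; rewrite count_map; case: (D2P A) => [[x x1 ->]|nA].
    rewrite -x1 -(cnt x); apply: eq_in_count => K KK /=; exact: mem_ch.
  apply/eqP; rewrite -leqn0 leqNgt -has_count; apply/hasPn => K KK /=.
  by apply/imsetP => -[x xK def_A]; apply: nA; exists x => //; apply: K1 xK.
- apply/mapP => -[K KK /esym/eqP]; rewrite imset_eq0 => /eqP K0.
  by rewrite -K0 KK in ne.
- move=> _ /mapP[K KK ->] _ _ /imsetP[x xK ->] /imsetP[y yK ->].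
  exact/connect_ch/con/yK.
move=> _ /mapP[K KK ->] _ B /imsetP[x xK ->] xB.
have /andP[_ /D2P[y y1 def_B]] := e2_D2 xB.
rewrite def_B imset_f //; apply: (clo K KK x) => //.
by rewrite -ch_mono ?def_B in xB *; rewrite // unfold_in; apply: K1 xK.
Qed.

Lemma card_transport K Ks : is_comps e1 Ks D1 -> K \in Ks ->
  #|ch @: (K : {set V1})| = #|K|.
Proof.
move=> cK KK; apply: card_in_imset => x y xK yK; apply: ch_inj.
  by rewrite unfold_in (is_comps_mem x cK); apply/hasP; exists K.
by rewrite unfold_in (is_comps_mem y cK); apply/hasP; exists K.
Qed.
End Transport.

Lemma card_transversals (V : finType) (x0 : V) (P : {set {set V}}) (D : {set V}) :
  partition P D ->
  #|[set X : {set V} | (X \subset D) && [forall K in P, #|X :&: K| == 1]]|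
  = \prod_(K in P) #|K|.
Proof.
case/and3P=> /eqP cover_P /trivIsetP triv _.
have block_eq K K' x : K \in P -> K' \in P -> x \in K -> x \in K' -> K = K'.
  move=> KP KP' xK xK'; apply/eqP/negPn/negP => /(triv K K' KP KP').
  by move/pred0P/(_ x); rewrite /= xK xK'.
pose F (K : {set V}) := [in K].
have -> : \prod_(K in P) #|K| = #|pfamily x0 [in P] F|.
  by rewrite card_pfamily foldrE big_map big_enum.
pose phi (h : {ffun {set V} -> V}) := [set h K | K in P].
have phiI h K : h \in pfamily x0 [in P] F -> K \in P -> phi h :&: K = [set h K].
  case/pfamilyP=> _ hP KP; apply/setP=> x; rewrite !inE; apply/andP/eqP.
    case=> /imsetP[K' KP' ->] hK'; congr (h _).
    exact: block_eq (hP _ KP') hK'.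
  by move=> ->; rewrite imset_f //; split=> //; apply: hP.
rewrite -(card_in_imset (f := phi)) => [|h1 h2 fam1 fam2 eq_phi]; last first.
  apply/ffunP=> K; case KP: (K \in P).
    by apply/set1P; rewrite -(phiI h2) // -eq_phi phiI // set11.
  have nP : K \notin [in P] by apply: (negbT KP).
  case/pfamilyP: fam1 => /supportP/(_ _ nP) -> _.
  by case/pfamilyP: fam2 => /supportP/(_ _ nP) -> _.
apply: eq_card => X; rewrite inE; apply/andP/imsetP => [[XD /forall_inP X1]|].
  pose h := [ffun K => if K \in P then odflt x0 [pick x in X :&: K] else x0].
  have hP K : K \in P -> X :&: K = [set h K].
    move=> KP; have /cards1P[x XK] := X1 K KP.
    rewrite ffunE KP XK; case: pickP => [y /set1P -> //|/(_ x)].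
    by rewrite set11.
  exists h.
    apply/pfamilyP; split=> [|K KP].
      by apply/supportP => K KP; rewrite ffunE ifN.
    by suff: h K \in X :&: K; [case/setIP|rewrite (hP K KP) set11].
  apply/setP=> x; apply/idP/imsetP => [xX|[K KP ->]].
    have : x \in cover P by rewrite cover_P (subsetP XD).
    case/bigcupP=> K KP xK; exists K => //; apply/set1P; rewrite -hP //.
    exact/setIP.
  by suff: h K \in X :&: K; [case/setIP|rewrite (hP K KP) set11].
case=> h fam ->; split.
  apply/subsetP=> _ /imsetP[K KP ->]; rewrite -cover_P; apply/bigcupP; exists K => //.
  by case/pfamilyP: fam => _; apply.
by apply/forall_inP=> K KP; rewrite phiI // cards1.
Qed.

Lemma uniq_pmap_inj (T1 T2 : eqType) (g : T1 -> option T2) (l : seq T1) s t a :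
  uniq (pmap g l) -> s \in l -> t \in l -> g s = Some a -> g t = Some a -> s = t.
Proof.
elim: l => [|z l IH] //= uniq_l; rewrite !inE.
have notin y b : y \in l -> g y = Some b -> g z = Some b -> False.
  move=> yl gy gz; move: uniq_l; rewrite gz /= mem_pmap => /andP[/mapP[]].
  by exists y.
have uniq' : uniq (pmap g l) by move: uniq_l; case: (g z) => //= b /andP[].
case/predU1P=> [->|sl] /predU1P[->|tl] // gs gt.
- by case: (notin t a).
- by case: (notin s a).
- exact: IH.
Qed.

Section Diagrams.
Variable n : nat.
Implicit Types (C : {set {set point n}}) (x y : point n).

Definition partner C x : point n :=
  odflt x [pick y | (y != x) && ([set x; y] \in C)].

Definition chord (f : point n -> point n) x : {set point n} := [set x; f x].

Definition chords (f : point n -> point n) : {set {set point n}} :=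
  [set chord f x | x : point n].

Lemma diagram_eq C A B x : is_chord_diagram C -> A \in C -> B \in C ->
  x \in A -> x \in B -> A = B.
Proof.
case/andP=> /and3P[_ /trivIsetP triv _] _ inA BC xA xB.
apply/eqP/negPn/negP => /(triv A B inA BC) /pred0P/(_ x).
by rewrite /= xA xB.
Qed.

Lemma set2_eqr x y z : y != x -> [set x; y] = [set x; z] -> y = z.
Proof.
move=> yx E; have : y \in [set x; z] by rewrite -E set22.
by rewrite !inE (negPf yx) => /eqP.
Qed.

Lemma partner_eq C x y : is_chord_diagram C -> y != x -> [set x; y] \in C ->
  partner C x = y.
Proof.
move=> dC yx xyC; rewrite /partner; case: pickP => [z /andP[zx xzC]|/(_ y)] /=.
  apply: (set2_eqr zx).
  exact: (diagram_eq dC xzC xyC (set21 x z) (set21 x y)).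
by rewrite yx xyC.
Qed.

Lemma partnerP C x : is_chord_diagram C ->
  (partner C x != x) && ([set x; partner C x] \in C).
Proof.
move=> dC; have /andP[/and3P[/eqP cover_C _ _] /forall_inP C2] := dC.
have : x \in cover C by rewrite cover_C inE.
case/bigcupP=> A inA xA; have /cards2P[a [b [ab def_A]]] := C2 A inA.
have [y yx def_A'] : exists2 y, y != x & A = [set x; y].
  move: xA; rewrite def_A => /set2P[->|->]; first by exists b; rewrite 1?eq_sym.
  by exists a; rewrite // setUC.
rewrite def_A' in inA.
by rewrite (partner_eq dC yx inA) yx.
Qed.

Lemma partner_neq C : is_chord_diagram C -> forall x, partner C x != x.
Proof. by move=> dC x; case/andP: (partnerP x dC). Qed.

Lemma partnerK C : is_chord_diagram C -> involutive (partner C).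
Proof.
move=> dC x; have /andP[px xC] := partnerP x dC.
by apply: partner_eq => //; rewrite 1?eq_sym // setUC.
Qed.

Lemma mem_diagram C x (A : {set point n}) : is_chord_diagram C -> x \in A ->
  (A \in C) = (A == chord (partner C) x).
Proof.
move=> dC xA; have /andP[_ xC] := partnerP x dC.
apply/idP/eqP => [inA|-> //]; exact: (diagram_eq dC inA xC xA (set21 _ _)).
Qed.

Lemma chords_partner C : is_chord_diagram C -> chords (partner C) = C.
Proof.
move=> dC; apply/setP=> A; apply/imsetP/idP => [[x _ ->]|inA].
  by case/andP: (partnerP x dC).
have /andP[/and3P[_ _ C0] _] := dC.
have /set0Pn[x xA] : A != set0 by apply: contraNneq C0 => <-.
by exists x => //; apply/eqP; rewrite -mem_diagram.
Qed.

Section FromInvolution.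
Variable f : point n -> point n.
Hypotheses (fK : involutive f) (f_neq : forall x, f x != x).

Lemma chord_eq x y : y \in chord f x -> chord f x = chord f y.
Proof. by case/set2P=> ->; rewrite // /chord fK setUC. Qed.

Lemma chords_diagram : is_chord_diagram (chords f).
Proof.
apply/andP; split; last first.
  by apply/forall_inP => _ /imsetP[x _ ->]; rewrite cards2 (eq_sym x) f_neq.
apply/and3P; split.
- rewrite eqEsubset subsetT; apply/subsetP=> x _; apply/bigcupP.
  by exists (chord f x); rewrite ?set21 // imset_f.
- apply/trivIsetP=> _ _ /imsetP[x _ ->] /imsetP[y _ ->]; apply: contraR.
  case/pred0Pn=> z /= /andP[zx zy].
  by rewrite (chord_eq zx) (chord_eq zy).
- by apply/imsetP => -[x _ /setP/(_ x)]; rewrite !inE eqxx.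
Qed.

Lemma partner_chords : partner (chords f) =1 f.
Proof.
by move=> x; apply: partner_eq chords_diagram (f_neq x) _; apply: imset_f.
Qed.
End FromInvolution.

Definition word C : (2 * n).-tuple (option (point n)) :=
  [tuple letter (partner C) x | x < 2 * n].

Lemma word_inj : {in @is_chord_diagram n &, injective word}.
Proof.
move=> C C' dC dC' eq_w.
have eq_l x : letter (partner C) x = letter (partner C') x.
  by have := congr1 (fun w => tnth w x) eq_w; rewrite !tnth_mktuple.
have half C1 C2 x : is_chord_diagram C1 -> is_chord_diagram C2 ->
    (forall y, letter (partner C1) y = letter (partner C2) y) ->
    partner C1 x < x -> partner C2 x = partner C1 x.
  move=> d1 d2 eq12 lt; have := eq12 x; rewrite /letter lt.
  by case: ifP => // _ [].
have eq_p : partner C =1 partner C'.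
  move=> x; have [lt|lt|/val_inj E] := ltngtP (partner C x) x.
  - by rewrite (half C C').
  - apply: (can_inj (partnerK dC')); rewrite (half C C') ?partnerK //.
  - by have := partner_neq dC x; rewrite E eqxx.
rewrite -(chords_partner dC) -(chords_partner dC').
by apply: eq_imset => x; rewrite /chord eq_p.
Qed.

Lemma run_word (K : idomainType) (u : K) M (w : (2 * n).-tuple (option (point n))) :
  run u M (enum 'I_(2 * n)) w [::] != 0%R ->
  exists2 C, is_chord_diagram C & w = word C.
Proof.
set g := tnth w; have def_w : tval w = map g (enum 'I_(2 * n)) by rewrite map_tnth_enum.
rewrite def_w => nz; have := run_perm nz; rewrite /= => perm_g.
have lt_g t a : g t = Some a -> a < t.
  apply: (run_closes_opened (lt := fun x y : 'I_(2 * n) => x < y) _ _ nz); rewrite ?mem_enum //.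
  have := iota_ltn_sorted 0 (2 * n); rewrite -val_enum_ord sorted_map.
  by rewrite sorted_pairwise // => x y z; apply: ltn_trans.
have g_inj s t a : g s = Some a -> g t = Some a -> s = t.
  apply: (uniq_pmap_inj (l := enum 'I_(2 * n))); rewrite ?mem_enum //.
  by rewrite (perm_uniq perm_g) filter_uniq // enum_uniq.
have g_opened t a : g t = Some a -> g a = None.
  move=> gt; have : a \in pmap g (enum 'I_(2 * n)).
    by rewrite mem_pmap; apply/mapP; exists t; rewrite ?mem_enum.
  by rewrite (perm_mem perm_g) mem_filter => /andP[/eqP].
have g_closed t : g t = None -> exists s, g s = Some t.
  move=> gt; have : t \in pmap g (enum 'I_(2 * n)).
    by rewrite (perm_mem perm_g) mem_filter gt mem_enum.
  by rewrite mem_pmap => /mapP[s _ gs]; exists s.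
pose f t := if g t is Some a then a else odflt t [pick s | g s == Some t].
have f_closed t a : g t = Some a -> f t = a by rewrite /f => ->.
have f_opened t s : g s = Some t -> f t = s.
  move=> gs; rewrite /f (g_opened _ _ gs); case: pickP => [s' /eqP gs'|/(_ s)] /=.
    exact: g_inj gs' gs.
  by rewrite gs eqxx.
have fP t : (f (f t) = t) /\ (f t != t).
  case gt: (g t) => [a|].
    rewrite (f_closed t a gt) (f_opened _ _ gt); split=> //.
    by apply: contraTneq (lt_g _ _ gt) => ->; rewrite ltnn.
  have [s gs] := g_closed t gt; rewrite (f_opened _ _ gs) (f_closed _ _ gs).
  by split=> //; apply: contraTneq (lt_g _ _ gs) => ->; rewrite ltnn.
have fK : involutive f by move=> t; case: (fP t).
have f_neq t : f t != t by case: (fP t).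
exists (chords f); first exact: chords_diagram.
apply: eq_from_tnth => t; rewrite tnth_mktuple /letter partner_chords // -/g.
case gt: (g t) => [a|]; first by rewrite (f_closed _ _ gt) (lt_g _ _ gt).
have [s gs] := g_closed t gt; rewrite (f_opened _ _ gs).
by rewrite ltnNge ltnW // lt_g.
Qed.

Lemma sum_diagrams (K : idomainType) (u : K) M :
  (\sum_(C | is_chord_diagram C) run u M (enum 'I_(2 * n)) (word C) [::]
   = walks u M (2 * n) [::])%R.
Proof.
have sum_k k : size (enum 'I_(2 * n)) = k ->
    (\sum_(w : k.-tuple (option 'I_(2 * n))) run u M (enum 'I_(2 * n)) w [::]
     = walks u M k [::])%R.
  by move=> <-; apply: sum_run; rewrite ?cats0 ?enum_uniq.
rewrite -sum_k ?size_enum_ord //.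
rewrite (bigID [in word @: [set C | is_chord_diagram C]]) /=.
rewrite [X in (_ + X)%R]big1 ?addr0 => [|w nw]; last first.
  apply/eqP; apply: contraNT nw => /run_word[C dC ->].
  by rewrite imset_f // inE.
rewrite big_imset /= => [|C C']; last by rewrite !inE; apply: word_inj.
by apply: eq_bigl => C; rewrite inE.
Qed.

Lemma set2_ltn (a b c d : point n) : a < b -> c < d -> [set a; b] = [set c; d] ->
  a = c /\ b = d.
Proof.
move=> ab cd E; have ac : a \in [set c; d] by rewrite -E set21.
have bc : b \in [set c; d] by rewrite -E set22.
move: ac bc; rewrite !inE => /orP[]/eqP ac /orP[]/eqP bc //; exfalso; move: ab cd; rewrite ac bc; lia.
Qed.

Lemma crossing_chords (f : point n -> point n) x y : x < f x -> y < f y ->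
  crossing (chord f x) (chord f y) = arc_cross f x y.
Proof.
move=> xf yf; rewrite /arc_cross xf yf /=; apply/idP/idP.
  case/existsP=> a /existsP[b /existsP[c /existsP[d /and3P[/eqP Ex /eqP Ey bd]]]].
  have [ac bd'] : a < c /\ b < d by lia.
  have [-> ->] := set2_ltn xf ac Ex; have [-> ->] := set2_ltn yf bd' Ey.
  exact: bd.
move=> H; apply/existsP; exists x; apply/existsP; exists y.
by apply/existsP; exists (f x); apply/existsP; exists (f y); rewrite !eqxx.
Qed.

Lemma crossing_sym : symmetric (@crossing n).
Proof.
have sub (A B : {set point n}) : crossing A B -> crossing B A; last first.
  by move=> A B; apply/idP/idP; apply: sub.
case/existsP=> a /existsP[b /existsP[c /existsP[d /and3P[eA eB H]]]].
apply/existsP; exists b; apply/existsP; exists a; apply/existsP; exists d.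
apply/existsP; exists c; by apply/and3P; split=> //; rewrite orbC.
Qed.

Lemma intersection_graph_sym C : symmetric (intersection_graph C).
Proof. by move=> A B; rewrite /intersection_graph /= crossing_sym andbCA. Qed.

Lemma components_partition C : partition (components C) C.
Proof.
apply: equivalence_partitionP => A B D _ _ _; split; first exact: connect0.
by move=> AB; apply: (same_connect (sym_connect_sym (intersection_graph_sym C)) AB).
Qed.

Local Open Scope ring_scope.

Lemma run_diagram (K : idomainType) (u : K) M C : is_chord_diagram C ->
  run u M (enum 'I_(2 * n)) (word C) [::] =
  if acyclic (intersection_graph C) then \prod_(L in components C) weight u M #|L|
  else 0.
Proof.
move=> dC; pose f := partner C.
have fK : involutive f := partnerK dC.
have f_neq x : f x != x := partner_neq dC x.
pose D1 := fun x : point n => (x < f x)%N.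
have D2P A : reflect (exists2 x, D1 x & A = chord f x) (A \in C).
  apply: (iffP idP) => [|[x _ ->]]; last by case/andP: (partnerP x dC).
  rewrite -(chords_partner dC) => /imsetP[x _ ->].
  have [lt|lt|/val_inj E] := ltngtP x (f x); first by exists x.
    by exists (f x); rewrite /D1 ?fK // /chord fK setUC.
  by have := f_neq x; rewrite -E eqxx.
have ch_inj : {in D1 &, injective (chord f)}.
  by move=> x y x1 y1 /(set2_ltn x1 y1)[].
have e1_D1 x y : arc_cross f x y -> D1 x && D1 y by case/and3P=> xf yf _; apply/andP.
have e2_D2 A B : intersection_graph C A B -> (A \in C) && (B \in C).
  by case/and3P=> -> ->.
have ch_mono : {in D1 &, forall x y,
    intersection_graph C (chord f x) (chord f y) = arc_cross f x y}.
  move=> x y x1 y1; rewrite /intersection_graph /= crossing_chords //.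
  have mem_chord z : chord f z \in C by case/andP: (partnerP z dC).
  by rewrite !mem_chord.
have acycE := acyclic_transport ch_inj D2P e1_D1 e2_D2 ch_mono.
have -> : tval (word C) = map (letter f) (enum 'I_(2 * n)) by [].
have [[acy [Ks [comps ->]]]|[cyc ->]] := run_letters fK f_neq u M; last first.
  by rewrite -acycE (negPf cyc).
rewrite -acycE acy; have comps2 := is_comps_transport ch_inj D2P e1_D1 e2_D2 ch_mono comps.
have [uniq2 part2] := is_comps_partition comps2.
have -> : components C = [set L in [seq chord f @: (L : {set point n}) | L <- Ks]].
  by rewrite -part2; congr equivalence_partition; apply/setP=> A; rewrite inE.
rewrite (eq_bigl [in [seq chord f @: (L : {set point n}) | L <- Ks]]) => [|L]; last first.
  by rewrite inE.
rewrite -big_uniq //= big_map /comp_weight !big_seq; apply: eq_bigr => L LK.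
by rewrite (card_transport ch_inj comps LK).
Qed.
End Diagrams.

Local Open Scope ring_scope.

Lemma card_rooting n (C : {set {set point n}}) :
  #|[set R | is_rooting C R]| = (\prod_(L in components C) #|L|)%N.
Proof.
rewrite -(card_transversals set0 (components_partition C)).
by apply: eq_card => R; rewrite !inE.
Qed.

Lemma r_sum n m : r n m =
  (\sum_(C : {set {set point n}} | is_forest_chord_diagram C && (#|components C| == m))
     \prod_(L in components C) #|L|)%N.
Proof.
rewrite /r -sum1_card.
rewrite (eq_bigl (fun CR : {set {set point n}} * {set {set point n}} =>
  (is_forest_chord_diagram CR.1 && (#|components CR.1| == m)) && is_rooting CR.1 CR.2)).
  rewrite -(pair_big_dep (fun C => is_forest_chord_diagram C && (#|components C| == m))
    (fun C R => is_rooting C R) (fun _ _ => 1%N)) /=.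
  apply: eq_bigr => C _; rewrite sum1_card -card_rooting.
  by apply: eq_card => R; rewrite inE.
by move=> CR; rewrite inE andbA.
Qed.

Lemma coef_prod_weight n m d (C : {set {set point n}}) :
  (#|{: {set point n}}| <= d)%N ->
  (\prod_(L in components C) weight ('X : {poly rat}) d.+1 #|L|)`_m =
  if #|components C| == m then (\prod_(L in components C) #|L|)%:R else 0.
Proof.
move=> le_d; rewrite /weight big_split /= prodr_const.
have -> : \prod_(L in components C) (omega d.+1 #|L|)%:R =
    ((\prod_(L in components C) #|L|)%:R : rat)%:P.
  rewrite natr_prod rmorph_prod; apply: eq_bigr => L _ /=.
  by rewrite polyC_natr /omega ltnS (leq_trans (max_card _)).
rewrite coefXnM coefC; case: ltngtP => [//|lt|->]; last by rewrite subnn.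
by rewrite subn_eq0 leqNgt lt.
Qed.

Theorem theorem2 (n m : nat) (n_gt0 : (0 < n)%N) (m_gt0 : (0 < m)%N)
    (le_mn : (m <= n)%N) :
  (r n m)%:R = 1 / m%:R * 'C(2 * n, m - 1)%:R * (Sigma1 n m + Sigma2 n m) :> rat.
Proof.
pose d := maxn n #|{: {set point n}}|.
rewrite -(coef_walks (d := d)) ?leq_maxl ?m_gt0 // -sum_diagrams coef_sum r_sum.
rewrite natr_sum /is_forest_chord_diagram big_mkcond [RHS]big_mkcond /=.
apply: eq_bigr => C _; case dC: (is_chord_diagram C) => //=.
rewrite run_diagram //; case: (acyclic _) => /=; last by rewrite coef0.
by rewrite coef_prod_weight ?leq_maxr //; case: eqP.
Qed.
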